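(* Let $H:\mathbb{T}^d\times\mathbb{R}^d\to\mathbb{R}$ be of class $C^1$, with $p\mapsto H(x,p)$ strictly convex for every $x\in\mathbb{T}^d$, and $\lim_{|p|\to\infty}\inf_{x\in\mathbb{T}^d}H(x,p)=+\infty$. Let $f:\mathbb{T}^d\times[0,\infty)\to\mathbb{R}$ be continuous, with $r\mapsto f(x,r)$ strictly increasing for every $x\in\mathbb{T}^d$, and suppose there is $C>0$ with $|f(x,r)|\le C(1+r^{q-1})$ for all $(x,r)\in\mathbb{T}^d\times[0,\infty)$. Assume moreover that $$H(x,0)=\min_{p\in\mathbb{R}^d}H(x,p)\quad\text{for every }x\in\mathbb{T}^d.$$ Let $(m,\lambda)$ be an ergodic pair. Then $$|\mathcal{R}_m^{\rm gap}|=0,$$ where $|\cdot|$ denotes Lebesgue measure.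
   Context: $\mathbb{T}^d$ is the $d$-dimensional flat torus, identified with $[0,1]^d$. Fix $s>1$, $q>1$ with conjugate exponents $s',q'$, and assume the Sobolev embedding $W^{1,s}(\mathbb{T}^d)\hookrightarrow L^{q'}(\mathbb{T}^d)$. A triple $(u,m,\lambda)\in W^{1,s}(\mathbb{T}^d)\times L^q(\mathbb{T}^d)\times\mathbb{R}$ is a weak solution to the ergodic problem if (i) $m\ge0$ a.e., $\int_{\mathbb{T}^d}m\,dx=1$ and $mD_pH(x,Du)\in L^{s'}(\mathbb{T}^d;\mathbb{R}^d)$; (ii) $H(x,Du)\le f(x,m)+\lambda$ a.e. on $\mathbb{T}^d$; (iii) $H(x,Du)=f(x,m)+\lambda$ a.e. on $\{m>0\}$; (iv) $-\operatorname{div}(mD_pH(x,Du))=0$ in $\mathcal{D}'(\mathbb{T}^d)$. For fixed $(m,\lambda)$, $\mathcal{E}(m,\lambda)$ denotes the set of $u$ such that $(u,m,\lambda)$ is a weak solution. An ergodic pair is a pair $(m,\lambda)\in L^q(\mathbb{T}^d)\times\mathbb{R}$ with $\mathcal{E}(m,\lambda)\neq\emptyset$. Regions: $\mathcal{O}_m$ is the union of all open $U\subset\mathbb{T}^d$ such that $m=0$ a.e. in $U$. After fixing a measurable representative of $m$, $\mathcal{P}_m:=\{m>0\}\setminus\mathcal{O}_m$ and $\mathcal{R}_m:=\mathbb{T}^d\setminus(\mathcal{P}_m\cup\mathcal{O}_m)$ (understood up to Lebesgue null sets). With $\ell(x):=\lambda+f(x,0)$ and $\underline{H}(x):=\min_{p\in\mathbb{R}^d}H(x,p)$,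 set $\mathcal{R}_m^{\rm gap}:=\mathcal{R}_m\cap\{x:\ell(x)>\underline{H}(x)\}$. *)

(* Defs.v *)
From HB Require Import structures.
From mathcomp Require Import all_boot all_order all_algebra.
From mathcomp Require Import all_classical all_reals all_analysis.

Set Implicit Arguments.
Unset Strict Implicit.
Unset Printing Implicit Defensive.
Import Order.TTheory GRing.Theory Num.Theory.
Import numFieldNormedType.Exports.
Local Open Scope classical_set_scope.
Local Open Scope ring_scope.

(* R^n carries the product sigma-algebra generated by the coordinates, i.e. the
   Borel sigma-algebra. *)
Fact measure_rV_display : measure_display. Proof. exact: default_measure_display. Qed.

Section measurable_rV.
Variables (R : realType) (n : nat).

Let coors : 'I_n -> 'rV[R]_n -> R := fun i x => x ord0 i.

Let rV_set0 : g_sigma_preimage coors set0.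
Proof. exact: sigma_algebra0. Qed.

Let rV_setC A : g_sigma_preimage coors A -> g_sigma_preimage coors (~` A).
Proof. exact: sigma_algebraC. Qed.

Let rV_bigcup (F : _^nat) : (forall i, g_sigma_preimage coors (F i)) ->
  g_sigma_preimage coors (\bigcup_i (F i)).
Proof. exact: sigma_algebra_bigcup. Qed.

HB.instance Definition _ := @isMeasurable.Build measure_rV_display
  'rV[R]_n (g_sigma_preimage coors) rV_set0 rV_setC rV_bigcup.

End measurable_rV.

Lemma measurable_coor (R : realType) n (i : 'I_n) :
  measurable_fun [set: 'rV[R]_n] (fun x => x ord0 i).
Proof.
move=> _ Y mY; rewrite setTI; apply: sub_sigma_algebra => /=.
rewrite -bigcup_seq/=; exists i => /=; first by rewrite mem_index_enum.
by exists Y => //; rewrite setTI.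
Qed.

Lemma measurable_fun_coorP (R : realType) d (T : measurableType d) n
    (f : T -> 'rV[R]_n) :
  (forall i, measurable_fun [set: T] (fun t => f t ord0 i)) ->
  measurable_fun [set: T] f.
Proof.
move=> mf _ A mA.
have /(_ A mA) : measurable `<=` image_set_system setT f measurable.
  apply: smallest_sub.
    exact/sigma_algebra_image/sigma_algebra_measurable.
  move=> B; rewrite -bigcup_seq /= => -[i _ [C mC <-]].
  by rewrite /image_set_system /= !setTI; have := mf i measurableT C mC; rewrite setTI.
by rewrite /image_set_system.
Qed.

Section lebesgue_rV.
Variable R : realType.

Definition rV_cons n (z : R * 'rV[R]_n) : 'rV[R]_n.+1 :=
  row_mx (const_mx z.1 : 'rV[R]_1) z.2.

Definition rV_uncons n (x : 'rV[R]_n.+1) : R * 'rV[R]_n :=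
  (x ord0 ord0, \row_i x ord0 (lift ord0 i)).

Lemma rV_cons0 n z : @rV_cons n z ord0 ord0 = z.1.
Proof. by rewrite mxE; case: splitP => // j _; rewrite mxE. Qed.

Lemma rV_consS n z i : @rV_cons n z ord0 (lift ord0 i) = z.2 ord0 i.
Proof.
rewrite mxE; case: splitP => [[[|//] ?] //|j /=].
by rewrite /bump /= !add1n => -[] /val_inj ->.
Qed.

Lemma rV_consK n : cancel (@rV_cons n) (@rV_uncons n).
Proof.
move=> [a y]; rewrite /rV_uncons rV_cons0; congr pair.
by apply/rowP => i; rewrite mxE rV_consS.
Qed.

Lemma measurable_rV_cons n : measurable_fun setT (@rV_cons n).
Proof.
apply: measurable_fun_coorP => i; case: (unliftP ord0 i) => [j|] ->.
  under eq_fun do rewrite rV_consS.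
  exact: (measurableT_comp (@measurable_coor R n j)).
under eq_fun do rewrite rV_cons0.
exact: measurable_fst.
Qed.

Lemma measurable_rV_uncons n : measurable_fun setT (@rV_uncons n).
Proof.
apply: measurable_fun_pair; first exact: measurable_coor.
apply: measurable_fun_coorP => i; under eq_fun do rewrite mxE.
exact: measurable_coor.
Qed.

Section step.
Variables (n : nat) (mu : {sigma_finite_measure set 'rV[R]_n -> \bar R}).

Definition lebesgue_rV_step : set 'rV[R]_n.+1 -> \bar R :=
  pushforward (@lebesgue_measure R \x mu)%E (@rV_cons n).

Let step0 : lebesgue_rV_step set0 = 0%E.
Proof. by rewrite /lebesgue_rV_step /pushforward preimage_set0 measure0. Qed.

Let step_ge0 A : (0 <= lebesgue_rV_step A)%E.
Proof. by rewrite /lebesgue_rV_step /pushforward; exact: measure_ge0. Qed.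

Let step_sigma_additive : semi_sigma_additive lebesgue_rV_step.
Proof.
exact: (@measure_semi_sigma_additive _ _ _
  (measure_function_pushforward__canonical__measure_function_Measure
    (@lebesgue_measure R \x mu)%E (@measurable_rV_cons n))).
Qed.

HB.instance Definition _ := isMeasure.Build _ _ _ lebesgue_rV_step
  step0 step_ge0 step_sigma_additive.

Let step_sigma_finite : sigma_finite setT lebesgue_rV_step.
Proof.
have [F FT Foo] : sigma_finite setT (@lebesgue_measure R \x mu)%E.
  have /sigma_finiteP[F [FT ndF Foo]] := sigma_finiteT (@lebesgue_measure R).
  have /sigma_finiteP[G [GT ndG Goo]] := sigma_finiteT mu.
  exists (fun k => F k `*` G k).
    rewrite -setXTT FT GT predeqE => -[x y]; split.
      move=> [/= [k _ Fkx] [l _ Gly]]; exists (maxn k l) => //; split.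
      - by move: x Fkx; exact/subsetPset/ndF/leq_maxl.
      - by move: y Gly; exact/subsetPset/ndG/leq_maxr.
    by move=> [k _ []/= ? ?]; split; exists k.
  move=> k; have [? ?] := Foo k; have [? ?] := Goo k.
  split; first exact: measurableX.
  by rewrite product_measure1E// lte_mul_pinfty// ge0_fin_numE.
exists (fun k => @rV_uncons n @^-1` F k).
  by rewrite -preimage_bigcup -FT preimage_setT.
move=> k; have [mF Fk] := Foo k; split.
  by rewrite -[X in measurable X]setTI; exact: measurable_rV_uncons.
rewrite /lebesgue_rV_step /pushforward -comp_preimage.
by rewrite (_ : _ \o _ = id) //; apply/funext => z /=; rewrite rV_consK.
Qed.

HB.instance Definition _ := Measure_isSigmaFinite.Build _ _ _ lebesgue_rV_step
  step_sigma_finite.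

End step.

(* The n-fold product of the one-dimensional Lebesgue measure; see lebesgue_rV_box. *)
Fixpoint lebesgue_rV n : {sigma_finite_measure set 'rV[R]_n -> \bar R} :=
  match n with
  | 0 => [the {sigma_finite_measure set _ -> \bar R} of dirac (0 : 'rV[R]_0)]
  | n'.+1 => [the {sigma_finite_measure set _ -> \bar R} of
               lebesgue_rV_step (lebesgue_rV n')]
  end.

End lebesgue_rV.

Lemma measurable_box (R : realType) n (A : 'I_n -> set R) :
  (forall i, measurable (A i)) ->
  measurable [set x : 'rV[R]_n | forall i, A i (x ord0 i)].
Proof.
move=> mA; have -> : [set x : 'rV[R]_n | forall i, A i (x ord0 i)] =
    \bigcap_(i in [set: 'I_n]) ((fun x : 'rV[R]_n => x ord0 i) @^-1` A i).
  by apply/seteqP; split => [x Ax i _|x Ax i]; exact: Ax.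
apply: fin_bigcap_measurable; first exact: finite_finset.
by move=> i _; rewrite -[X in measurable X]setTI; exact: measurable_coor.
Qed.

Lemma lebesgue_rV_box (R : realType) n (A : 'I_n -> set R) :
  (forall i, measurable (A i)) ->
  lebesgue_rV R n [set x | forall i, A i (x ord0 i)] =
  (\prod_(i < n) lebesgue_measure (A i))%E.
Proof.
elim: n A => [|n IH] A mA.
  rewrite big_ord0 /= diracE (_ : _ \in _ = true) //.
  by apply/mem_set => -[].
rewrite big_ord_recl -(IH (fun i => A (lift ord0 i))) //.
have mB := measurable_box (fun i => mA (lift ord0 i)).
rewrite -product_measure1E //; last exact: mA.
rewrite /= /lebesgue_rV_step /pushforward; congr (_ _).
apply/seteqP; split => [[a y] /= H|[a y] /= [H0 H] i].
  split; first by have := H ord0; rewrite rV_cons0.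
  by move=> i; have := H (lift ord0 i); rewrite rV_consS.
by case: (unliftP ord0 i) => [j|] ->; rewrite ?rV_consS ?rV_cons0.
Qed.

(* A function on T^d is a Z^d-periodic function on R^d, a subset of T^d is a
   Z^d-periodic subset of R^d, and integration over T^d is integration over the
   fundamental domain [0,1]^d. *)

Section torus.
Variables (R : realType) (d : nat).
Local Notation point := 'rV[R]_d.

Definition zperiodic (T : Type) (g : point -> T) : Prop :=
  forall (x : point) (k : 'rV[int]_d), g (x + map_mx intr k) = g x.

Definition unit_cube : set point := [set x | forall i, x ord0 i \in `[0, 1]].

Lemma measurable_unit_cube : measurable unit_cube.
Proof. exact: (@measurable_box R d (fun=> `[0, 1]%classic)). Qed.

Definition torus_measure : set point -> \bar R :=
  mrestr (lebesgue_rV R d) measurable_unit_cube.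

HB.instance Definition _ := Measure.on torus_measure.

Let torus_measureT : torus_measure setT = 1%E.
Proof.
rewrite /torus_measure /mrestr setTI.
rewrite (@lebesgue_rV_box R d (fun=> `[0, 1]%classic)) //.
by apply: big1 => i _; rewrite lebesgue_measure_itv /= lte_fin ltr01 sube0.
Qed.

HB.instance Definition _ :=
  Measure_isProbability.Build _ _ _ torus_measure torus_measureT.

Definition Lp_torus (p : R) (g : point -> R) : Prop :=
  zperiodic g /\ g \in Lfun torus_measure p%:E.

Definition Lp_torus_vec (p : R) (V : point -> point) : Prop :=
  forall i, Lp_torus p (fun x => V x ord0 i).

(* Used at points where g is differentiable, so that the partial derivatives
   determine the differential. *)
Definition gradient (g : point -> R) (x : point) : point :=
  \row_i 'D_(delta_mx ord0 i) g x.

(* In finite dimension, continuity of all directional derivatives amounts to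
   continuity of the differential, hence this is the usual class C^k. *)
Fixpoint Ck (V : normedModType R) (k : nat) (g : V -> R) : Prop :=
  if k is k'.+1 then
    (forall x, differentiable g x) /\ (forall v, Ck k' ('D_v g))
  else continuous g.

Definition test_function (phi : point -> R) : Prop :=
  zperiodic phi /\ forall k, Ck k phi.

Definition dotp (v w : point) : R := \sum_i v ord0 i * w ord0 i.

Definition weak_gradient (u : point -> R) (Du : point -> point) : Prop :=
  forall phi, test_function phi -> forall i,
    (\int[torus_measure]_x (u x * gradient phi x ord0 i) =
     - \int[torus_measure]_x (Du x ord0 i * phi x))%R.

(* u belongs to W^{1,s}(T^d) and Du represents its (a.e. unique) gradient. *)
Definition sobolev (s : R) (u : point -> R) (Du : point -> point) : Prop :=
  [/\ Lp_torus s u, Lp_torus_vec s Du & weak_gradient u Du].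

Definition torus_norm (p : R) (g : point -> R) : \bar R :=
  'N[torus_measure]_p%:E[EFin \o g]%E.

Definition sobolev_norm (s : R) (u : point -> R) (Du : point -> point) : \bar R :=
  (torus_norm s u + \sum_(i < d) torus_norm s (fun x => Du x ord0 i))%E.

Definition sobolev_embedding (s r : R) : Prop :=
  exists C : R, forall u Du, sobolev s u Du ->
    Lp_torus r u /\ (torus_norm r u <= C%:E * sobolev_norm s u Du)%E.

Definition weakly_divergence_free (V : point -> point) : Prop :=
  forall phi, test_function phi ->
    (\int[torus_measure]_x dotp (V x) (gradient phi x) = 0)%R.

Definition strictly_convex (g : point -> R) : Prop :=
  forall p1 p2 t, p1 != p2 -> 0 < t -> t < 1 ->
    g (t *: p1 + (1 - t) *: p2) < t * g p1 + (1 - t) * g p2.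

(* inf_x H(x,p) tends to +oo as |p| tends to +oo; `|p| is the sup norm, which is
   equivalent to the Euclidean one. *)
Definition uniformly_coercive (H : point -> point -> R) : Prop :=
  forall A : R, exists r : R, forall p, r <= `|p| ->
    (A%:E <= ereal_inf [set (H x p)%:E | x in [set: point]])%E.

(* min_p H(x,p); the infimum is attained when H is continuous and coercive. *)
Definition Hmin (H : point -> point -> R) (x : point) : R :=
  inf (range (H x)).

Definition DpH (H : point -> point -> R) (x p : point) : point :=
  gradient (H x) p.

(* Elements of L^q(T^d) are everywhere defined measurable functions; the regions
   below are computed from that representative of m. *)

Section ergodic.
Variables (s s' q : R) (H : point -> point -> R) (f : point -> R -> R).

Definition flux (m : point -> R) (Du : point -> point) (x : point) : point :=
  m x *: DpH H x (Du x).

Definition weak_solution (u m : point -> R) (lam : R) : Prop :=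
  Lp_torus q m /\
  exists Du : point -> point,
    [/\ sobolev s u Du,
        [/\ {ae torus_measure, forall x, 0 <= m x},
            (\int[torus_measure]_x m x = 1)%R &
            Lp_torus_vec s' (flux m Du)],
        {ae torus_measure, forall x, H x (Du x) <= f x (m x) + lam},
        {ae torus_measure, forall x, 0 < m x -> H x (Du x) = f x (m x) + lam} &
        weakly_divergence_free (flux m Du)].

Definition ergodic_set (m : point -> R) (lam : R) : set (point -> R) :=
  [set u | weak_solution u m lam].

Definition ergodic_pair (m : point -> R) (lam : R) : Prop :=
  Lp_torus q m /\ ergodic_set m lam !=set0.

End ergodic.

Definition O_region (m : point -> R) : set point :=
  \bigcup_(U in [set U : set point | [/\ open U, zperiodic U &
      {ae torus_measure, forall x, U x -> m x = 0}]]) U.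

Definition P_region (m : point -> R) : set point :=
  [set x | 0 < m x] `\` O_region m.

Definition R_region (m : point -> R) : set point :=
  ~` (P_region m `|` O_region m).

Definition ell (f : point -> R -> R) (lam : R) (x : point) : R := lam + f x 0.

Definition R_gap (H : point -> point -> R) (f : point -> R -> R)
    (m : point -> R) (lam : R) : set point :=
  R_region m `&` [set x | ell f lam x > Hmin H x].

End torus.

(* Main.v *)
Require Import Defs.
From mathcomp Require Import all_boot all_order all_algebra.
From mathcomp Require Import all_classical all_reals all_analysis.
From mathcomp Require Import finmap measurable_realfun lra ring.
Import Order.TTheory GRing.Theory Num.Theory.
Import numFieldNormedType.Exports.
Set Implicit Arguments.
Unset Strict Implicit.
Unset Printing Implicit Defensive.
Local Open Scope classical_set_scope.
Local Open Scope ring_scope.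

(** Let [G] be the set where [ell > Hmin]. Since [Hmin x = H x 0], it is open
and periodic. The point is that [m = 0] almost everywhere on [G]: then [G] is
one of the open sets whose union is [O_region m], so the gap region, which lies
in [G] and outside of [O_region m], is empty.

To see that [m] vanishes on [G], test the continuity equation with [u] itself:
the integral of [m DpH(x, Du) . Du] is zero. As [H x] is strictly convex with
minimum at [0], the product [DpH(x, p) . p] is positive for [p != 0], so the
integrand is nonnegative and [Du = 0] almost everywhere on [{m > 0}]. There the
Hamilton-Jacobi equation reads [H x 0 = f x (m x) + lam > f x 0 + lam], i.e.
[Hmin x > ell x], which excludes [G] ([density_vanishes_on_gap]).

Testing with [u], which is only in [W^{1,s}] while test functions are smooth, is
[div_free_orthogonal]: a divergence-free [V] in [L^{s'}] is orthogonal to a weak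
gradient [Du] in [L^s]. It is proved by regularization with the kernel
[K n (x, y)], the product over the coordinates of [p_n (x_i - y_i)], where [p_n]
is a normalized power of [cos^2 (pi t)]. Two facts are needed.

- Expanding the cosines, [K n (x, y)] is a finite sum of products
  [a_k(x) b_k(y)] of trigonometric polynomials. So the double integral of
  [sum_i V_i(x) Du_i(y) K n (x, y)] only involves the pairings of [V] and [Du]
  with test functions. The weak gradient moves the derivative onto [b_k], the
  dependence of [K n] on [x - y] alone turns it into minus a derivative of
  [a_k], and what remains is [V] tested against the gradients of the [a_k],
  which is zero ([torus_kernel_test_sum]).

- Viewed as a measure on pairs of points, [K n] has both marginals equal to
  Lebesgue measure and concentrates on the diagonal. This forces the double
  integral of [V(x) W(y) K n (x, y)] to converge to the integral of [V W], for
  [V] and [W] in conjugate Lebesgue spaces ([avg_mul_cvg]).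

Concentration is only checked by hand for half-spaces [{x_i > a}], a
one-dimensional computation ([per_kernel_ray]): the measurable sets that a pair
of points rarely separates form a sigma-algebra
([sigma_algebra_concentrates]). *)

(** * Kernels concentrating on the diagonal *)

(** Convergence to [0] of a nonnegative extended-real sequence. This form, unlike
a limit in the topology of extended reals, adds up and compares without any
finiteness side condition. *)
Definition vanishing (R : realType) (a : nat -> \bar R) : Prop :=
  forall e : R, 0 < e -> \forall n \near \oo, (a n <= e%:E)%E.

Section vanishing.
Context (R : realType).
Implicit Types a b : nat -> \bar R.

Lemma vanishing_le a b : (forall n, (a n <= b n)%E) -> vanishing b -> vanishing a.
Proof.
move=> ab b0 e e0; near=> n; apply: (le_trans (ab n)).
by near: n; exact: b0.
Unshelve. all: by end_near. Qed.

Lemma vanishingD a b : vanishing a -> vanishing b ->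
  vanishing (fun n => a n + b n)%E.
Proof.
move=> a0 b0 e e0; have e20 : 0 < e / 2 by rewrite divr_gt0.
near=> n; rewrite [e]splitr EFinD; apply: leeD; near: n; [exact: a0|exact: b0].
Unshelve. all: by end_near. Qed.

Lemma vanishingZ a (c : R) : 0 <= c -> (forall n, (0 <= a n)%E) -> vanishing a ->
  vanishing (fun n => c%:E * a n)%E.
Proof.
move=> c0 age0 a0 e e0; have c10 : 0 < c + 1 by rewrite ltr_wpDl.
have ec0 : 0 < e / (c + 1) by rewrite divr_gt0.
near=> n; apply: (@le_trans _ _ ((c + 1)%:E * (e / (c + 1))%:E)%E); last first.
  by rewrite -EFinM lee_fin mulrC divfK// gt_eqF.
apply: lee_pmul => //; first by rewrite lee_fin ler_wpDr.
by near: n; exact: a0.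
Unshelve. all: by end_near. Qed.

Lemma vanishing_approx a :
  (forall e : R, 0 < e -> exists2 b, vanishing b & forall n, (a n <= b n + e%:E)%E) ->
  vanishing a.
Proof.
move=> H e e0; have e20 : 0 < e / 2 by rewrite divr_gt0.
have [b b0 ab] := H _ e20.
near=> n; rewrite [e]splitr EFinD; apply: (le_trans (ab n)).
apply: leeD => //; near: n; exact: b0.
Unshelve. all: by end_near. Qed.

Lemma cvge0_vanishing a : a @ \oo --> 0%E -> vanishing a.
Proof.
move=> a0 e e0.
have H : \forall n \near \oo, (a n < e%:E)%E.
  exact: a0 (@nbhs_open_ereal_lt R 0 (fun=> e) e0).
by apply: filterS H => n /ltW.
Qed.

End vanishing.

Section coupling.
Context d (T : measurableType d) (R : realType) (mu : probability T R).
Variable K : nat -> T * T -> R.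
Hypothesis mK : forall n, measurable_fun setT (K n).
Hypothesis K0 : forall n z, 0 <= K n z.
Hypothesis K1 : forall n x, (\int[mu]_y (K n (x, y))%:E = 1)%E.
Hypothesis K2 : forall n y, (\int[mu]_x (K n (x, y))%:E = 1)%E.

Local Notation m2 := (mu \x mu)%E.

Implicit Types (n : nat) (F G : T * T -> R) (f g : T -> R) (A B : set T).

(** Integration against the measure on pairs of points with density [K n]. By
[K1] and [K2] both of its marginals are [mu]: it is a coupling of [mu] with
itself, which is what [avg_fst] and [avg_snd] express. *)
Definition avg n (F : T * T -> R) : \bar R := (\int[m2]_z (F z * K n z)%:E)%E.

Lemma avg_ge0 n F : (forall z, 0 <= F z) -> (0 <= avg n F)%E.
Proof. by move=> F0; apply: integral_ge0 => z _; rewrite lee_fin mulr_ge0. Qed.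

Let mFK n F : measurable_fun setT F ->
  measurable_fun setT (EFin \o (fun z => F z * K n z)).
Proof. by move=> mF; apply/measurable_EFinP/measurable_funM. Qed.

Lemma le_avg n F G : measurable_fun setT F -> measurable_fun setT G ->
  (forall z, 0 <= F z) -> (forall z, F z <= G z) -> (avg n F <= avg n G)%E.
Proof.
move=> mF mG F0 FG; apply: ge0_le_integral => //; try exact: mFK.
- by move=> z _; rewrite lee_fin mulr_ge0.
- by move=> z _; rewrite lee_fin ler_wpM2r.
Qed.

Lemma avgD n F G : measurable_fun setT F -> measurable_fun setT G ->
  (forall z, 0 <= F z) -> (forall z, 0 <= G z) ->
  avg n (fun z => F z + G z) = (avg n F + avg n G)%E.
Proof.
move=> mF mG F0 G0; rewrite /avg -ge0_integralD//; try exact: mFK.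
- by apply: eq_integral => z _; rewrite mulrDl EFinD.
- by move=> z _; rewrite lee_fin mulr_ge0.
- by move=> z _; rewrite lee_fin mulr_ge0.
Qed.

Lemma avgZ n F c : measurable_fun setT F -> (forall z, 0 <= F z) -> 0 <= c ->
  avg n (fun z => c * F z) = (c%:E * avg n F)%E.
Proof.
move=> mF F0 c0; rewrite /avg -ge0_integralZl//; try exact: mFK.
- by apply: eq_integral => z _; rewrite -mulrA EFinM.
- by move=> z _; rewrite lee_fin mulr_ge0.
Qed.

Lemma avg_fst n (f : T -> R) : measurable_fun setT f -> (forall x, 0 <= f x) ->
  avg n (fun z => f z.1) = (\int[mu]_x (f x)%:E)%E.
Proof.
move=> mf f0; rewrite /avg fubini_tonelli1.
- apply: eq_integral => x _; rewrite /fubini_F /=.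
  under eq_integral do rewrite EFinM.
  rewrite ge0_integralZl// ?K1 ?mule1//.
  + apply/measurable_EFinP; exact: measurable_fun_pair2.
  + by move=> y _; rewrite lee_fin.
  + by rewrite lee_fin.
- exact: (@mFK n (fun z => f z.1) (measurableT_comp mf measurable_fst)).
- by move=> z; rewrite lee_fin mulr_ge0.
Qed.

Lemma avg_snd n (f : T -> R) : measurable_fun setT f -> (forall x, 0 <= f x) ->
  avg n (fun z => f z.2) = (\int[mu]_x (f x)%:E)%E.
Proof.
move=> mf f0; rewrite /avg fubini_tonelli2.
- apply: eq_integral => x _; rewrite /fubini_G /=.
  under eq_integral do rewrite EFinM.
  rewrite ge0_integralZl// ?K2 ?mule1//.
  + apply/measurable_EFinP; exact: measurable_fun_pair1.
  + by move=> y _; rewrite lee_fin.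
  + by rewrite lee_fin.
- exact: (@mFK n (fun z => f z.2) (measurableT_comp mf measurable_snd)).
- by move=> z; rewrite lee_fin mulr_ge0.
Qed.

(** For an indicator function this is the probability that the set separates the
two points of a pair. *)
Definition osc n (f : T -> R) : \bar R := avg n (fun z => `|f z.1 - f z.2|).

Lemma osc_ge0 n f : (0 <= osc n f)%E.
Proof. exact: avg_ge0. Qed.

Lemma measurable_osc f : measurable_fun setT f ->
  measurable_fun setT (fun z : T * T => `|f z.1 - f z.2|).
Proof.
move=> mf; apply: measurableT_comp => //; apply: measurable_funB.
  exact: measurableT_comp.
exact: measurableT_comp.
Qed.

Lemma measurable_dist (f g : T -> R) : measurable_fun setT f ->
  measurable_fun setT g -> measurable_fun setT (fun x => `|f x - g x|).
Proof. by move=> mf mg; apply: measurableT_comp => //; exact: measurable_funB. Qed.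

(** The marginal condition makes [osc n] continuous for the [L^1] distance,
uniformly in [n]. *)
Lemma osc_le n f g : measurable_fun setT f -> measurable_fun setT g ->
  (osc n f <= osc n g + 2%:E * \int[mu]_x `|f x - g x|%:E)%E.
Proof.
move=> mf mg; have mfg := measurable_dist mf mg.
have m1 : measurable_fun setT (fun z : T * T => `|f z.1 - g z.1|).
  exact: (measurableT_comp mfg).
have m2' : measurable_fun setT (fun z : T * T => `|f z.2 - g z.2|).
  exact: (measurableT_comp mfg).
rewrite mule_natl mule2n -{1}(avg_fst n mfg)// -(avg_snd n mfg)//.
rewrite -avgD// -avgD//; first last.
- exact: measurable_funD.
- exact: measurable_osc.
apply: le_avg => //.
- exact: measurable_osc.
- by apply: measurable_funD; [exact: measurable_osc|exact: measurable_funD].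
- move=> z /=.
  have -> : f z.1 - f z.2 = (g z.1 - g z.2) + ((f z.1 - g z.1) - (f z.2 - g z.2)) by ring.
  by rewrite (le_trans (ler_normD _ _))// lerD2l (le_trans (ler_normB _ _)).
Qed.

Definition concentrates (f : T -> R) := vanishing (osc^~ f).

Lemma concentrates_approx f : measurable_fun setT f ->
  (forall e : R, 0 < e -> exists g, [/\ measurable_fun setT g, concentrates g &
    (\int[mu]_x `|f x - g x|%:E <= e%:E)%E]) -> concentrates f.
Proof.
move=> mf H; apply: vanishing_approx => e e0.
have [|g [mg cg fg]] := H (e / 2); first by rewrite divr_gt0.
exists (osc^~ g) => // n; apply: (le_trans (osc_le n mf mg)); apply: leeD => //.
rewrite [in leRHS](_ : e = 2 * (e / 2)); last by rewrite mulrCA divff ?mulr1.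
by rewrite EFinM; apply: lee_pmul => //; exact: integral_ge0.
Qed.

Lemma concentratesC A : concentrates (\1_A) -> concentrates (\1_(~` A)).
Proof.
rewrite /concentrates; congr (vanishing _); apply/funext => n.
apply: eq_integral => z _; congr ((_ * _)%:E).
rewrite !indicE !in_setC; do 2 case: (_ \in A) => /=;
  by rewrite ?subrr ?normr0 ?subr0 ?sub0r ?normrN.
Qed.

Lemma concentratesU A B : measurable A -> measurable B ->
  concentrates (\1_A) -> concentrates (\1_B) -> concentrates (\1_(A `|` B)).
Proof.
move=> mA mB cA cB; apply: (vanishing_le _ (vanishingD cA cB)) => n.
have mo C : measurable C -> measurable_fun setT (fun z : T * T => `|\1_C z.1 - \1_C z.2 : R|).
  by move=> mC; apply: measurable_osc; exact: measurable_indic.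
rewrite -avgD//; try exact: mo.
apply: le_avg => //.
- by apply: mo; exact: measurableU.
- by apply: measurable_funD; exact: mo.
- move=> z; rewrite !indicE !in_setU.
  do 2 case: (_ \in A) => /=; do 2 case: (_ \in B) => /=;
  rewrite ?subrr ?normr0 ?subr0 ?sub0r ?normrN ?normr1 ?addr0 ?add0r //=; lra.
Qed.

(** A countable union is the [L^1] limit of finite unions, so the uniform
continuity of [osc n] applies. *)
Lemma concentrates_bigcup (F : (set T)^nat) : (forall i, measurable (F i)) ->
  (forall i, concentrates (\1_(F i))) -> concentrates (\1_(\bigcup_i F i)).
Proof.
move=> mF cF.
have mU : measurable (\bigcup_i F i) by exact: bigcup_measurable.
pose G n := \big[setU/set0]_(i < n.+1) F i.
have mG n : measurable (G n) by exact: bigsetU_measurable.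
have cG n : concentrates (\1_(G n)).
  elim: n => [|n IH]; first by rewrite /G big_ord1.
  by rewrite /G big_ord_recr /=; apply: concentratesU => //; exact: mG.
have GU : \bigcup_n G n = \bigcup_i F i by exact: bigcup_bigsetU_bigcup.
have GS n : G n `<=` \bigcup_i F i by rewrite -GU; exact: bigcup_sup.
have muG : mu (G n) @[n --> \oo] --> mu (\bigcup_i F i).
  rewrite -GU; apply: nondecreasing_cvg_mu => //; first by rewrite GU.
  by move=> m n mn; apply/subsetPset/subset_bigsetU.
apply: concentrates_approx => [|e e0]; first exact: measurable_indic.
have [n Hn] : exists n, (mu (\bigcup_i F i) - mu (G n) <= e%:E)%E.
  have : (mu (\bigcup_i F i) - mu (G n))%E @[n --> \oo] --> 0%E.
    rewrite -(@subee _ (mu (\bigcup_i F i))) ?fin_num_measure//.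
    apply: cvgeB; [|exact: cvg_cst|exact: muG].
    by rewrite fin_num_adde_defl// fin_numN fin_num_measure.
  by move=> /cvge0_vanishing /(_ e e0) [N _ /(_ N (leqnn N))]; exists N.
exists (\1_(G n)); split => //.
apply: le_trans Hn.
have <- : mu (\bigcup_i F i `\` G n) = (mu (\bigcup_i F i) - mu (G n))%E.
  rewrite measureD//; first by rewrite setIidr.
  by rewrite -ge0_fin_numE// fin_num_measure.
rewrite -[X in mu X]setIT -integral_indic//; last exact: measurableD.
apply: ge0_le_integral => //.
- apply/measurable_EFinP/measurable_dist; first exact: measurable_indic.
  exact/measurable_indic/mG.
- by apply/measurable_EFinP/measurable_indic; exact: measurableD.
- move=> x _; rewrite lee_fin !indicE in_setD.
  have [xG|xG] := boolP (x \in G n); last by rewrite subr0 andbT ger0_norm.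
  by rewrite (_ : x \in _) ?subrr ?normr0//; apply/mem_set/(GS n)/set_mem.
Qed.

Lemma sigma_algebra_concentrates :
  sigma_algebra setT [set A | measurable A /\ concentrates (\1_A)].
Proof.
split => /=.
- split=> // e e0; apply: nearW => n.
  rewrite /osc /avg integral0_eq ?lee_fin ?ltW// => z _.
  by rewrite indic0 subrr normr0 mul0r.
- by move=> B [mB cB]; rewrite setTD; split; [exact: measurableC|exact: concentratesC].
- move=> F HF; split; first by apply: bigcup_measurable => i _; exact: (HF i).1.
  by apply: concentrates_bigcup => i; have [] := HF i.
Qed.

Lemma concentratesD f g : measurable_fun setT f -> measurable_fun setT g ->
  concentrates f -> concentrates g -> concentrates (fun x => f x + g x).
Proof.
move=> mf mg cf cg; apply: (vanishing_le _ (vanishingD cf cg)) => n.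
rewrite -avgD//; try exact: measurable_osc.
apply: le_avg => //.
- exact: (measurable_osc (measurable_funD mf mg)).
- by apply: measurable_funD; exact: measurable_osc.
- by move=> z; rewrite opprD addrACA ler_normD.
Qed.

Lemma concentratesZ (c : R) f : measurable_fun setT f ->
  concentrates f -> concentrates (fun x => c * f x).
Proof.
move=> mf cf; have := vanishingZ (normr_ge0 c) (fun n => osc_ge0 n f) cf.
congr (vanishing _); apply/funext => n; rewrite -avgZ//; last exact: measurable_osc.
by apply: eq_integral => z _; rewrite -mulrBr normrM.
Qed.

Hypothesis concK : forall A, measurable A -> concentrates (\1_A).

Import HBSimple.

Lemma concentrates_sfun (h : {sfun T >-> R}) : concentrates h.
Proof.
have -> : (h : T -> R) =
    (fun x => \sum_(y <- fset_set (range h)) y * \1_(h @^-1` [set y]) x).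
  by apply/funext => x; rewrite fimfunE fsbig_finite.
suff : forall s : seq R,
    let g := fun x => \sum_(y <- s) y * \1_(h @^-1` [set y]) x in
    measurable_fun setT g /\ concentrates g by case/(_ (fset_set (range h))).
have mh y : measurable (h @^-1` [set y]).
  by rewrite -[X in measurable X]setTI; exact: measurable_funP.
elim=> [|y s [ms cs]] /=.
  under eq_fun do rewrite big_nil; split; first exact: measurable_cst.
  move=> e e0; apply: nearW => n.
  rewrite /osc /avg integral0_eq ?lee_fin ?ltW// => z _.
  by rewrite subrr normr0 mul0r.
under eq_fun do rewrite big_cons.
have my : measurable_fun setT (fun x => y * (\1_(h @^-1` [set y]) x : R)).
  by apply: measurable_funM => //; exact: measurable_indic.
split; first exact: measurable_funD.
apply: concentratesD => //; apply: concentratesZ; last exact: concK.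
exact: measurable_indic.
Qed.

(** From sets to simple functions by linearity, then to all integrable functions
by density in [L^1]. *)
Lemma concentrates_integrable f : mu.-integrable setT (EFin \o f) -> concentrates f.
Proof.
move=> intf; have mf : measurable_fun setT f.
  by apply/measurable_EFinP; exact: measurable_int intf.
apply: concentrates_approx => // e e0.
have [h [_ _ /cvge0_vanishing /(_ e e0)]] := approximation_sfun_integrable measurableT intf.
move=> [N _ /(_ N (leqnn N)) /= Hh]; exists (h N); split => //.
exact: concentrates_sfun.
Qed.

End coupling.

(** Young's inequality, rescaled so that the weight of one of the two terms is as
small as desired. *)
Lemma young_weighted (R : realType) (p q k : R) : 1 < p -> 1 < q ->
  p^-1 + q^-1 = 1 -> 0 < k -> exists2 D : R, 0 < D &
  forall a b : R, 0 <= a -> 0 <= b -> a * b <= D * a `^ p + k * b `^ q.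
Proof.
move=> p1 q1 pq k0; have p0 := lt_trans ltr01 p1; have q0 := lt_trans ltr01 q1.
pose h := k `^ q^-1; have h0 : 0 < h by rewrite powR_gt0.
exists (h^-1 `^ p); first by rewrite powR_gt0// invr_gt0.
move=> a b a0 b0.
have -> : a * b = (h^-1 * a) * (h * b) by rewrite mulrACA mulVf ?mul1r// gt_eqF.
have h0' : 0 <= h^-1 by rewrite invr_ge0 ltW.
apply: (le_trans (@conjugate_powR R _ _ p q _ _ p0 q0 pq)).
- exact: mulr_ge0.
- by rewrite mulr_ge0// ltW.
have -> : k * b `^ q = (h * b) `^ q.
  by rewrite powRM ?(ltW h0)// -powRrM mulVf ?gt_eqF// powRr1// ltW.
rewrite -powRM//; apply: lerD; rewrite ler_piMr ?powR_ge0// invf_le1//; exact: ltW.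
Qed.

Section bilinear.
Context d (T : measurableType d) (R : realType) (mu : probability T R).
Variable K : nat -> T * T -> R.
Hypothesis mK : forall n, measurable_fun setT (K n).
Hypothesis K0 : forall n z, 0 <= K n z.
Hypothesis K1 : forall n x, (\int[mu]_y (K n (x, y))%:E = 1)%E.
Hypothesis K2 : forall n y, (\int[mu]_x (K n (x, y))%:E = 1)%E.
Hypothesis concK : forall A, measurable A -> concentrates mu K (\1_A).

Variables (p q : R) (V W : T -> R).
Hypotheses (p1 : 1 < p) (q1 : 1 < q) (pq : p^-1 + q^-1 = 1).
Hypotheses (LV : V \in Lfun mu p%:E) (LW : W \in Lfun mu q%:E).

Local Notation m2 := (mu \x mu)%E.
Local Notation avg := (avg mu K).

Let mV : measurable_fun setT V.
Proof. by have /sub_Lfun_mfun /set_mem := LV. Qed.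
Let mW : measurable_fun setT W.
Proof. by have /sub_Lfun_mfun /set_mem := LW. Qed.

Let iV : mu.-integrable setT (fun x => (`|V x| `^ p)%:E).
Proof. by apply: Lfun_integrable => //; exact: ltW. Qed.
Let iW : mu.-integrable setT (fun x => (`|W x| `^ q)%:E).
Proof. by apply: Lfun_integrable => //; exact: ltW. Qed.

Let mpow (f : T -> R) (r : R) : measurable_fun setT f ->
  measurable_fun setT (fun x => f x `^ r).
Proof. by move=> mf; apply: (measurableT_comp (measurable_powR _)). Qed.

Let mfst (f : T -> R) : measurable_fun setT f ->
  measurable_fun setT (fun z : T * T => f z.1).
Proof. by move=> mf; exact: measurableT_comp. Qed.
Let msnd (f : T -> R) : measurable_fun setT f ->
  measurable_fun setT (fun z : T * T => f z.2).
Proof. by move=> mf; exact: measurableT_comp. Qed.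

Let avgZ_fst n (c : R) (f : T -> R) : measurable_fun setT f ->
  (forall x, 0 <= f x) -> 0 <= c ->
  avg n (fun z => c * f z.1) = (c%:E * \int[mu]_x (f x)%:E)%E.
Proof.
move=> mf f0 c0; rewrite -(avg_fst mK K0 K1 n mf f0).
by rewrite (@avgZ _ _ _ _ _ mK K0 n (fun z => f z.1))//; exact: mfst.
Qed.

Let avgZ_snd n (c : R) (f : T -> R) : measurable_fun setT f ->
  (forall x, 0 <= f x) -> 0 <= c ->
  avg n (fun z => c * f z.2) = (c%:E * \int[mu]_x (f x)%:E)%E.
Proof.
move=> mf f0 c0; rewrite -(avg_snd mK K0 K2 n mf f0).
by rewrite (@avgZ _ _ _ _ _ mK K0 n (fun z => f z.2))//; exact: msnd.
Qed.

Let pow_ge0 (f : T -> R) (r : R) x : 0 <= f x `^ r.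
Proof. exact: powR_ge0. Qed.

(** The excess of [|V|] over the level [M]: it tends to [0] in [L^p], and what is
left of [V] is bounded. *)
Let tail (M : nat) (x : T) : R := Num.max 0 (`|V x| - M%:R).

Let tail_ge0 M x : 0 <= tail M x.
Proof. by rewrite /tail le_max lexx. Qed.

Let mtail M : measurable_fun setT (tail M).
Proof.
apply: measurable_maxr => //; apply: measurable_funB => //.
exact: measurableT_comp.
Qed.

Let tail_cvg : vanishing (fun M => \int[mu]_x (tail M x `^ p)%:E)%E.
Proof.
apply: cvge0_vanishing.
have [] := @dominated_convergence _ T R mu setT measurableT
  (fun M x => (tail M x `^ p)%:E) (cst 0%E) (fun x => (`|V x| `^ p)%:E) => //.
- by move=> M; apply/measurable_EFinP/mpow.
- apply/aeW => x _; apply: cvg_near_cst.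
  near=> M; congr (_%:E); rewrite /tail (_ : Num.max _ _ = 0).
    by rewrite powR0// gt_eqF// (lt_trans ltr01).
  apply/max_idPl; rewrite subr_le0; near: M; exact: nbhs_infty_ger.
- apply/aeW => x M _; rewrite gee0_abs ?lee_fin ?powR_ge0//.
  rewrite ge0_ler_powR// ?nnegrE// ?(le_trans ler01 (ltW p1))//.
  by rewrite /tail ge_max normr_ge0 lerBlDr lerDl ler0n.
- move=> _ _; rewrite integral0 => H; apply: cvg_trans H.
Unshelve. all: by end_near. Qed.

(** Below the level [N], the factor [|V|] is bounded and concentration of the
integrable function [W] suffices. Above it, the weighted Young inequality with a
small weight [k] on [|W|^q] bounds the mean by a multiple of the [p]-th moment
of the excess, which is small for large [N], plus [k] times the [q]-th moment of
[W]. *)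
Lemma avg_prod_vanishing :
  vanishing (fun n => avg n (fun z => `|V z.1| * `|W z.1 - W z.2|)).
Proof.
apply: vanishing_approx => e e0.
pose B := fine (\int[mu]_x (`|W x| `^ q)%:E)%E.
have B0 : 0 <= B by apply: fine_ge0; apply: integral_ge0 => x _; rewrite lee_fin powR_ge0.
have EB : (\int[mu]_x (`|W x| `^ q)%:E = B%:E)%E.
  by rewrite fineK//; exact: integrable_fin_num.
have k0 : 0 < e / (4 * (B + 1)) by rewrite divr_gt0// mulr_gt0// ltr_wpDl.
have [D D0 HD] := young_weighted p1 q1 pq k0.
have [N _ /(_ N (leqnn N)) /= HN] : \forall M \near \oo,
    (\int[mu]_x (tail M x `^ p)%:E <= (e / (4 * D))%:E)%E.
  by apply: tail_cvg; rewrite divr_gt0// mulr_gt0.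
have intW : mu.-integrable setT (EFin \o W).
  apply/Lfun1_integrable; apply: Lfun_subset LW => //; rewrite ?lee_fin ?(ltW q1)//.
  exact: fin_num_measure.
exists (fun n => N%:R%:E * osc mu K n W)%E.
  by apply: vanishingZ => //; [move=> n; exact: osc_ge0|exact: concentrates_integrable].
move=> n.
set k := e / _ in HD.
pose G z := (D * tail N z.1 `^ p + k * `|W z.1| `^ q) +
            (D * tail N z.1 `^ p + k * `|W z.2| `^ q).
have k0' := ltW k0; have D0' := ltW D0.
have mtp : measurable_fun setT (fun z : T * T => D * tail N z.1 `^ p).
  by apply: measurable_funM => //; exact: (mfst (mpow p (mtail N))).
have mW1 : measurable_fun setT (fun z : T * T => k * `|W z.1| `^ q).
  apply: measurable_funM => //; apply: (mfst (f := fun x => `|W x| `^ q)).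
  by apply: mpow; exact: measurableT_comp.
have mW2 : measurable_fun setT (fun z : T * T => k * `|W z.2| `^ q).
  apply: measurable_funM => //; apply: (msnd (f := fun x => `|W x| `^ q)).
  by apply: mpow; exact: measurableT_comp.
have mG : measurable_fun setT G.
  by apply: measurable_funD; apply: measurable_funD.
have mNo : measurable_fun setT (fun z : T * T => N%:R * `|W z.1 - W z.2|).
  by apply: measurable_funM => //; exact: measurable_osc.
have G0 z : 0 <= G z.
  by rewrite /G !addr_ge0// mulr_ge0 ?powR_ge0.
apply: (@le_trans _ _ (avg n (fun z => N%:R * `|W z.1 - W z.2| + G z))).
  apply: le_avg => //.
  - apply: measurable_funM; last exact: measurable_osc.
    by apply: (mfst (f := fun x => `|V x|)); exact: measurableT_comp.
  - exact: measurable_funD.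
  - move=> z; apply: (@le_trans _ _ ((N%:R + tail N z.1) * `|W z.1 - W z.2|)).
      by apply: ler_wpM2r => //; rewrite /tail -lerBlDl le_max lexx orbT.
    rewrite mulrDl lerD2l /G.
    apply: (@le_trans _ _ (tail N z.1 * (`|W z.1| + `|W z.2|))).
      by apply: ler_wpM2l => //; exact: ler_normB.
    by rewrite mulrDr; apply: lerD; exact: HD.
rewrite avgD//.
apply: leeD; first by rewrite avgZ//; exact: measurable_osc.
have c0 (c u : R) (r : R) : 0 <= c -> 0 <= c * u `^ r by move=> ?; rewrite mulr_ge0 ?powR_ge0.
rewrite /G avgD//; try (exact: measurable_funD); try (by move=> z; rewrite addr_ge0 ?c0).
rewrite !avgD//; try (by move=> z; rewrite c0).
have mWq : measurable_fun setT (fun x => `|W x| `^ q).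
  by apply: mpow; exact: measurableT_comp.
rewrite (avgZ_fst n (mpow p (mtail N)) (@pow_ge0 _ _) D0').
rewrite (avgZ_fst n mWq (@pow_ge0 _ _) k0') (avgZ_snd n mWq (@pow_ge0 _ _) k0') EB.
have HT : (D%:E * \int[mu]_x (tail N x `^ p)%:E <= (e / 4)%:E)%E.
  apply: (@le_trans _ _ (D%:E * (e / (4 * D))%:E)%E).
    apply: lee_pmul => //; rewrite ?lee_fin//.
    by apply: integral_ge0 => x _; rewrite lee_fin powR_ge0.
  by rewrite -EFinM lee_fin (_ : D * _ = e / 4)//; field; rewrite gt_eqF.
have Hk : (k%:E * B%:E <= (e / 4)%:E)%E.
  have B1 : 0 < B + 1 by rewrite ltr_wpDl.
  rewrite -EFinM lee_fin /k (_ : _ * B = e / 4 * (B / (B + 1))); last first.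
    by field; rewrite gt_eqF.
  rewrite ler_piMr//; first by rewrite divr_ge0// ltW.
  by rewrite ler_pdivrMr// mul1r lerDl.
(* Each of the four terms is at most e / 4. *)
rewrite [X in (_ <= X%:E)%E](_ : e = (e/4 + e/4) + (e/4 + e/4)); last by field.
by rewrite !EFinD; apply: leeD; apply: leeD.
Qed.

(** By the first marginal, the integral of [V W] is the mean over pairs of
[V(x) W(x)]; replacing [W(x)] by [W(y)] costs at most the quantity that
[avg_prod_vanishing] controls. *)
Lemma avg_mul_cvg : (fun n => (\int[m2]_z (V z.1 * W z.2 * K n z))%R) @ \oo -->
  (\int[mu]_x (V x * W x))%R.
Proof.
have [D D0 HD] := young_weighted p1 q1 pq ltr01.
have finV : (\int[mu]_x (`|V x| `^ p)%:E < +oo)%E.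
  by rewrite ltey_eq integrable_fin_num.
have finW : (\int[mu]_x (`|W x| `^ q)%:E < +oo)%E.
  by rewrite ltey_eq integrable_fin_num.
have mVp : measurable_fun setT (fun x => `|V x| `^ p).
  by apply: mpow; exact: measurableT_comp.
have mWq : measurable_fun setT (fun x => `|W x| `^ q).
  by apply: mpow; exact: measurableT_comp.
have intavg n (F : T * T -> R) : measurable_fun setT F ->
    (avg n (fun z => `|F z|%R) < +oo)%E -> m2.-integrable setT (EFin \o (fun z => F z * K n z)).
  move=> mF Fn; apply/integrableP; split.
    exact/measurable_EFinP/measurable_funM.
  apply: le_lt_trans Fn; apply: ge0_le_integral => //.
  - apply: measurableT_comp => //; exact/measurable_EFinP/measurable_funM.
  - apply/measurable_EFinP/measurable_funM => //; exact: measurableT_comp.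
  - by move=> z _; rewrite /= lee_fin normrM (ger0_norm (K0 n z)).
have mVz := mfst mV; have mWz := msnd mW; have mW1 := mfst mW.
have iF1 n : m2.-integrable setT (EFin \o (fun z => V z.1 * W z.2 * K n z)).
  apply: intavg; first exact: measurable_funM.
  apply: (@le_lt_trans _ _ (avg n (fun z => D * `|V z.1| `^ p + 1 * `|W z.2| `^ q))).
    apply: le_avg => //.
    - by apply: measurableT_comp => //; exact: measurable_funM.
    - apply: measurable_funD; apply: measurable_funM => //.
        exact: (mfst mVp).
      exact: (msnd mWq).
    - by move=> z; rewrite normrM; exact: HD.
  rewrite avgD//.
  - rewrite (avgZ_fst n mVp (@pow_ge0 _ _) (ltW D0)) (avgZ_snd n mWq (@pow_ge0 _ _) ler01) mul1e.
    by apply: lte_add_pinfty => //; apply: lte_mul_pinfty; rewrite ?lee_fin ?(ltW D0).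
  - by apply: measurable_funM => //; exact: (mfst mVp).
  - by apply: measurable_funM => //; exact: (msnd mWq).
  - by move=> z; rewrite mulr_ge0 ?powR_ge0// ltW.
have iF2 n : m2.-integrable setT (EFin \o (fun z => V z.1 * W z.1 * K n z)).
  apply: (intavg n (fun z => V z.1 * W z.1)); first exact: measurable_funM.
  have mDV : measurable_fun setT (fun x => D * `|V x| `^ p) by exact: measurable_funM.
  have mDW : measurable_fun setT (fun x => 1 * `|W x| `^ q) by exact: measurable_funM.
  apply: (@le_lt_trans _ _ (avg n (fun z => D * `|V z.1| `^ p + 1 * `|W z.1| `^ q))).
    apply: le_avg => //.
    - by apply: measurableT_comp => //; exact: measurable_funM.
    - apply: measurable_funD; [exact: (mfst mDV)|exact: (mfst mDW)].
    - by move=> z; rewrite normrM; exact: HD.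
  rewrite avgD//.
  - rewrite (avgZ_fst n mVp (@pow_ge0 _ _) (ltW D0)) (avgZ_fst n mWq (@pow_ge0 _ _) ler01) mul1e.
    by apply: lte_add_pinfty => //; apply: lte_mul_pinfty; rewrite ?lee_fin ?(ltW D0).
  - exact: (mfst mDV).
  - exact: (mfst mDW).
  - by move=> z; rewrite mulr_ge0 ?powR_ge0// ltW.
have E2 n : (\int[mu]_x (V x * W x) = \int[m2]_z (V z.1 * W z.1 * K n z))%R.
  rewrite /Rintegral -(integral12_prod_meas1 (iF2 n)); congr fine.
  apply: eq_integral => x _; rewrite /fubini_F /=.
  have iK : mu.-integrable setT (fun y => (K n (x, y))%:E).
    apply/integrableP; split; first by apply/measurable_EFinP; exact: measurable_fun_pair2.
    under eq_integral do rewrite gee0_abs ?lee_fin//.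
    by rewrite K1 ltry.
  under eq_integral do rewrite EFinM.
  by rewrite integralZl// K1 mule1.
apply/cvgrPdist_le => e e0; near=> n.
rewrite (E2 n) distrC -RintegralB//.
apply: (le_trans (le_normr_Rintegral _ _)) => //.
  exact: (integrableB measurableT (iF1 n) (iF2 n)).
have H : (avg n (fun z => `|V z.1| * `|W z.1 - W z.2|)%R <= e%:E)%E.
  by near: n; exact: avg_prod_vanishing.
rewrite -lee_fin; apply: le_trans H; rewrite /Rintegral.
have E z : `|V z.1 * W z.2 * K n z - V z.1 * W z.1 * K n z| =
   `|V z.1| * `|W z.1 - W z.2| * K n z.
  by rewrite -mulrBl -mulrBr !normrM (ger0_norm (K0 n z)) (distrC (W z.2)).
under eq_integral do rewrite E.
rewrite fineK// ge0_fin_numE; last exact: avg_ge0.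
apply: (@le_lt_trans _ _ e%:E); last exact: ltry.
by near: n; exact: avg_prod_vanishing.
Unshelve. all: by end_near. Qed.

End bilinear.

(** * The one-dimensional periodic kernel *)

Section cos_kernel.
Context (R : realType).
Implicit Types (t x y : R) (n k : nat).

Let is_derive_pi t : is_derive t 1 (fun u : R => pi * u) pi.
Proof.
have := is_deriveZ (pi : R) (is_derive_id t (1 : R)).
by rewrite [_ *: _](_ : _ = pi) //; rewrite /GRing.scale /= mulr1.
Qed.

(** The reduction formula for powers of the cosine: the derivative of
[sin * cos^(k+1)] is [(k+2) cos^(k+2) - (k+1) cos^k], up to the factor [pi]. *)
Lemma cosX_primitive k : exists P : R -> R,
  forall t, is_derive t 1 P (cos (pi * t) ^+ k).
Proof.
have ds t : is_derive t 1 (fun u : R => sin (pi * u)) (cos (pi * t) * pi).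
  exact: (is_derive1_comp (is_derive_sin (pi * t)) (is_derive_pi t)).
have dc t : is_derive t 1 (fun u : R => cos (pi * u)) (- sin (pi * t) * pi).
  exact: (is_derive1_comp (is_derive_cos (pi * t)) (is_derive_pi t)).
have pi0 : pi != 0 :> R by rewrite gt_eqF ?pi_gt0.
elim/ltn_ind: k => -[|[|k]] IH.
- by exists id => t; rewrite expr0; exact: is_derive_id.
- exists (fun t => pi^-1 * sin (pi * t)) => t.
  have := is_deriveZ pi^-1 (ds t); congr is_derive.
  change (pi^-1 * (cos (pi * t) * pi) = cos (pi * t) ^+ 1).
  by rewrite expr1 mulrCA mulVf ?mulr1.
- have [|Q dQ] := IH k; first exact: ltnW.
  exists (fun t => k.+2%:R^-1 *
    (pi^-1 * (sin (pi * t) * cos (pi * t) ^+ k.+1) + k.+1%:R * Q t)) => t.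
  have dX : is_derive t 1 (fun u : R => cos (pi * u) ^+ k.+1)
      (k.+1%:R * cos (pi * t) ^+ k * (- sin (pi * t) * pi)).
    have := is_deriveX k.+1 (dc t); congr is_derive.
    by apply/funext => u; rewrite exprfctE.
  have dM := is_deriveZ pi^-1 (is_deriveM (ds t) dX).
  have := is_deriveZ k.+2%:R^-1 (is_deriveD dM (is_deriveZ k.+1%:R (dQ t))).
  congr is_derive.
  change (k.+2%:R^-1 * (pi^-1 * (sin (pi * t) *
      ((k.+1%:R * cos (pi * t) ^+ k) * (- sin (pi * t) * pi)) +
      cos (pi * t) ^+ k.+1 * (cos (pi * t) * pi)) + k.+1%:R * cos (pi * t) ^+ k) =
    cos (pi * t) ^+ k.+2).
  have s2 := sin2cos2 (pi * t : R).
  set s := sin _ in s2 *; set c := cos _ in s2 *.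
  have -> : pi^-1 * (s * (k.+1%:R * c ^+ k * (- s * pi)) + c ^+ k.+1 * (c * pi)) =
      pi^-1 * pi * (- (k.+1%:R * c ^+ k * s ^+ 2) + c ^+ k.+2) by rewrite !exprS; ring.
  rewrite mulVf// mul1r.
  have k0 : k.+2%:R != 0 :> R by rewrite pnatr_eq0.
  by apply: (mulfI k0); rewrite mulrA divff// mul1r s2 -natr1 !exprS; ring.
Qed.


Let ler_cos : {in `[0, pi] &, {mono (@cos R) : x y /~ y <= x}}.
Proof. by move=> x y x0 y0; rewrite !leNgt ltr_cos. Qed.

Definition cosX n t := cos (pi * t) ^+ n.*2.

Lemma cosX_ge0 n t : 0 <= cosX n t.
Proof. by rewrite /cosX -mul2n exprM exprn_ge0// sqr_ge0. Qed.

Lemma cosXN n t : cosX n (- t) = cosX n t.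
Proof. by rewrite /cosX mulrN cosN. Qed.

Lemma cosXB1 n t : cosX n (t - 1) = cosX n t.
Proof.
rewrite /cosX -mul2n !exprM; congr (_ ^+ _).
by rewrite -[in RHS](subrK 1 t) [in RHS]mulrDr mulr1 cosDpi sqrrN.
Qed.

Lemma continuous_cosX n : continuous (cosX n).
Proof.
move=> t; apply: (@continuous_comp _ _ _ (fun u : R => cos (pi * u)) (fun u => u ^+ n.*2)).
  apply: (@continuous_comp _ _ _ (fun u : R => pi * u) cos); first exact: mulrl_continuous.
  exact: continuous_cos.
exact: exprn_continuous.
Qed.

Lemma measurable_cosX n : measurable_fun setT (cosX n).
Proof. by apply: continuous_measurable_fun; exact: continuous_cosX. Qed.

Local Notation leb := (@lebesgue_measure R).

Definition cosX_mass n : R := fine (\int[leb]_(y in `[0%R, 1%R]) (cosX n (0 - y))%:E).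

(** Translation invariance over a period. In terms of a primitive [P] the left
side is [P x - P (x - 1)], whose derivative in [x] is zero by periodicity. *)
Lemma integral_cosX n x :
  (\int[leb]_(y in `[0%R, 1%R]) (cosX n (x - y))%:E = (cosX_mass n)%:E)%E.
Proof.
have [P dP] := cosX_primitive n.*2.
have FTC z : (\int[leb]_(y in `[0%R, 1%R]) (cosX n (z - y))%:E = (P z - P (z - 1))%:E)%E.
  have dF y : is_derive y 1 (fun y : R => - P (z - y)) (cosX n (z - y)).
    have d1 : is_derive y 1 (fun y : R => z - y) (- 1).
      have := is_deriveB (is_derive_cst z y (1 : R)) (is_derive_id y (1 : R)).
      by rewrite sub0r.
    have := is_deriveN (@is_derive1_comp _ P (fun y => z - y) y _ _ (dP (z - y)) d1).
    by congr is_derive; rewrite mulrN1 opprK.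
  have cF : continuous (fun y : R => - P (z - y)).
    move=> y; apply: differentiable_continuous; apply/derivable1_diffP.
    by have [] := dF y.
  rewrite (@continuous_FTC2 _ _ (fun y => - P (z - y)))//.
  - by rewrite subr0 -EFinB opprK addrC.
  - apply: continuous_subspaceT => y.
    apply: (@continuous_comp _ _ _ (fun y : R => z - y) (cosX n)); last exact: continuous_cosX.
    by apply: continuousB; [exact: cst_continuous|exact: cvg_id].
  - split; first by move=> y _; have [] := dF y.
      exact/cvg_at_right_filter/cF.
    exact/cvg_at_left_filter/cF.
  - by move=> y _; rewrite derive1E; have [_ ->] := dF y.
have dd y : is_derive y 1 (fun z : R => P z - P (z - 1)) 0.
  have d1 : is_derive y 1 (fun y : R => y - 1) 1.
    have := is_deriveB (is_derive_id y (1 : R)) (is_derive_cst (1 : R) y (1 : R)).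
    by rewrite subr0.
  have := is_deriveB (dP y) (@is_derive1_comp _ P (fun y => y - 1) y _ _ (dP (y - 1)) d1).
  by congr is_derive; rewrite mulr1 -/(cosX n y) -/(cosX n (y - 1)) cosXB1 subrr.
by rewrite /cosX_mass !FTC /= (is_derive_0_is_cst x 0 dd).
Qed.

Lemma cosX_mass_ge n (h : R) : 0 < h -> h <= 2^-1 -> h * cosX n h <= cosX_mass n.
Proof.
move=> h0 h2; rewrite -lee_fin -(integral_cosX n 0).
have mf : measurable_fun setT (fun y : R => (cosX n (0 - y))%:E).
  apply/measurable_EFinP; apply: (measurableT_comp (measurable_cosX n)).
  exact: measurable_funB.
apply: (@le_trans _ _ (\int[leb]_(y in `[0%R, h]) (cosX n h)%:E)%E).
  rewrite integral_cst//= lebesgue_measure_itv /= lte_fin h0 sube0 -EFinM lee_fin.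
  by rewrite mulrC.
apply: (@le_trans _ _ (\int[leb]_(y in `[0%R, h]) (cosX n (0 - y))%:E)%E).
  apply: ge0_le_integral => //.
  - by move=> y _; rewrite lee_fin cosX_ge0.
  - exact: measurable_funTS.
  move=> y /=; rewrite in_itv /= => /andP[y0 yh].
  have pi0 := pi_gt0 R.
  rewrite lee_fin sub0r cosXN /cosX lerXn2r// ?nnegrE ?cos_ge0_pihalf//.
  - apply/andP; split; nra.
  - apply/andP; split; nra.
  - rewrite ler_cos ?ler_pM2l// in_itv /=; apply/andP; split; nra.
apply: ge0_subset_integral => //.
- exact: measurable_funTS.
- by move=> y _; rewrite lee_fin cosX_ge0.
- by apply: subset_itvl; rewrite bnd_simp; lra.
Qed.

Lemma cosX_mass_gt0 n : 0 < cosX_mass n.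
Proof.
have pi0 := pi_gt0 R.
have h0 : (0 : R) < 4^-1 by rewrite invr_gt0.
apply: lt_le_trans (cosX_mass_ge n h0 _); last by rewrite lef_pV2 ?posrE// ler_nat.
rewrite mulr_gt0// exprn_gt0// cos_gt0_pihalf//; apply/andP; split; lra.
Qed.

(** The de la Vallee-Poussin kernel on the circle of length [1]. *)
Definition per_kernel n t := cosX n t / cosX_mass n.

Lemma per_kernel_ge0 n t : 0 <= per_kernel n t.
Proof. by rewrite divr_ge0 ?cosX_ge0// ltW ?cosX_mass_gt0. Qed.

Lemma per_kernelN n t : per_kernel n (- t) = per_kernel n t.
Proof. by rewrite /per_kernel cosXN. Qed.

Lemma measurable_per_kernel n : measurable_fun setT (per_kernel n).
Proof. by apply: measurable_funM => //; exact: measurable_cosX. Qed.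

Lemma integral_per_kernel n x :
  (\int[leb]_(y in `[0%R, 1%R]) (per_kernel n (x - y))%:E = 1)%E.
Proof.
have c0 := cosX_mass_gt0 n.
rewrite /per_kernel; under eq_integral do rewrite mulrC EFinM.
rewrite ge0_integralZl//.
- by rewrite integral_cosX -EFinM mulVf// gt_eqF.
- apply: measurable_funTS; apply/measurable_EFinP.
  apply: (measurableT_comp (measurable_cosX n)); exact: measurable_funB.
- by move=> y _; rewrite lee_fin cosX_ge0.
- by rewrite lee_fin invr_ge0 ltW.
Qed.

(** Away from the integers [cos^2 (pi t)] is at most [cos^2 (pi h)], while the
total mass is at least [h/2] times the [n]-th power of the larger number
[cos^2 (pi h/2)]. The quotient decays geometrically. *)
Lemma per_kernel_tail (h : R) : 0 < h -> h <= 2^-1 ->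
  exists2 a : nat -> R, a @ \oo --> 0 &
    forall n t, h <= `|t| -> `|t| <= 1 - h -> per_kernel n t <= a n.
Proof.
move=> h0 h2; have pi0 := pi_gt0 R.
pose r := cos (pi * h) ^+ 2 / cos (pi * (h / 2)) ^+ 2.
have c1 : 0 < cos (pi * (h / 2)).
  by rewrite cos_gt0_pihalf//; apply/andP; split; nra.
have c2 : 0 <= cos (pi * h).
  by rewrite cos_ge0_pihalf//; apply/andP; split; nra.
have c12 : cos (pi * h) < cos (pi * (h / 2)).
  rewrite ltr_cos ?in_itv /=; try (apply/andP; split; nra).
  by rewrite ltr_pM2l//; lra.
have r0 : 0 <= r by rewrite divr_ge0 ?sqr_ge0.
have r1 : r < 1.
  rewrite /r ltr_pdivrMr ?exprn_gt0// mul1r ltrXn2r// ?nnegrE// ltW//.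
exists (fun n => (h / 2)^-1 * r ^+ n).
  rewrite -[X in _ --> X](mulr0 (h / 2)^-1); apply: cvgMr; apply: cvg_expr.
  by rewrite ger0_norm.
move=> n t ht t1.
have ct : cosX n t <= cosX n h.
  rewrite /cosX -mul2n !exprM; apply: lerXn2r; rewrite ?nnegrE ?sqr_ge0//.
  rewrite -(cos_norm (pi * t)) normrM (gtr0_norm pi0).
  rewrite -ler_sqrt ?sqr_ge0// !sqrtr_sqr (ger0_norm c2) ler_norml; apply/andP; split.
    rewrite -(cosN (pi * h)) -cosDpi.
    by rewrite ler_cos ?in_itv /=; try (apply/andP; split); nra.
  by rewrite ler_cos ?in_itv /=; try (apply/andP; split); nra.
have h20 : 0 < h / 2 by rewrite divr_gt0.
have cm : h / 2 * cosX n (h / 2) <= cosX_mass n by apply: cosX_mass_ge => //; lra.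
have ch : 0 < cosX n (h / 2) by rewrite exprn_gt0.
rewrite /per_kernel ler_pdivrMr ?cosX_mass_gt0//; apply: (le_trans ct).
apply: (@le_trans _ _ ((h / 2)^-1 * r ^+ n * (h / 2 * cosX n (h / 2)))); last first.
  by apply: ler_wpM2l => //; rewrite mulr_ge0 ?exprn_ge0// invr_ge0 ltW.
rewrite mulrACA mulVf ?gt_eqF// mul1r /r /cosX -mul2n !exprM -exprMn divfK//.
by rewrite expf_neq0// gt_eqF.
Qed.


(** Given a threshold [a], [jump n] is the kernel restricted to the pairs that [a]
separates, and [crossing n t] the mass that it sends from [t] to the other
side. *)
Section ray.
Variable a : R.
Local Notation B := (`]a, +oo[%classic : set R).

Definition jump n (z : R * R) : R := `|\1_B z.1 - \1_B z.2| * per_kernel n (z.1 - z.2).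

Lemma jump_ge0 n z : 0 <= jump n z.
Proof. by rewrite mulr_ge0// per_kernel_ge0. Qed.

Let measurable_indic_itv (A : interval R) :
  measurable_fun setT (\1_[set` A] : R -> R).
Proof. by apply: measurable_indic. Qed.

Lemma measurable_jump n : measurable_fun setT (jump n).
Proof.
apply: measurable_funM.
  apply: measurableT_comp => //; apply: measurable_funB.
    exact: (measurableT_comp (measurable_indic_itv `]a, +oo[) measurable_fst).
  exact: (measurableT_comp (measurable_indic_itv `]a, +oo[) measurable_snd).
apply: (measurableT_comp (measurable_per_kernel n)); exact: measurable_funB.
Qed.

Definition crossing n t := (\int[leb]_(r in `[0%R, 1%R]) (jump n (t, r))%:E)%E.

Lemma measurable_crossing n : measurable_fun setT (crossing n).
Proof.
pose F (z : R * R) := ((jump n z)%:E * (\1_`[0%R, 1%R] z.2)%:E)%E.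
have -> : crossing n = fubini_F leb F.
  apply/funext => t; rewrite /crossing /fubini_F [LHS]integral_mkcond.
  by apply: eq_integral => r _; rewrite patchE /F indicE; case: ifP; rewrite ?mule1 ?mule0.
apply: measurable_fun_fubini_tonelli_F.
- apply: emeasurable_funM; first by apply/measurable_EFinP; exact: measurable_jump.
  apply/measurable_EFinP.
  exact: (measurableT_comp (measurable_indic_itv `[0, 1]) measurable_snd).
- by move=> z; rewrite mule_ge0// lee_fin jump_ge0.
Qed.

Lemma crossing_ge0 n t : (0 <= crossing n t)%E.
Proof. by apply: integral_ge0 => r _; rewrite lee_fin jump_ge0. Qed.

Let indic_dist_le1 (t r : R) : `|\1_B t - \1_B r| <= (1 : R).
Proof.
by rewrite !indicE; do 2 case: (_ \in _);
  rewrite /= ?subrr ?normr0 ?subr0 ?sub0r ?normrN ?normr1.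
Qed.

Let mslice n t : measurable_fun setT (fun r => (jump n (t, r))%:E).
Proof. by apply/measurable_EFinP; exact: (measurable_fun_pair2 _ (measurable_jump n)). Qed.

Lemma crossing_le1 n t : (crossing n t <= 1)%E.
Proof.
rewrite -(integral_per_kernel n t); apply: ge0_le_integral => //.
- by move=> r _; rewrite lee_fin jump_ge0.
- by apply: measurable_funTS; exact: mslice.
- apply: measurable_funTS; apply/measurable_EFinP.
  apply: (measurableT_comp (measurable_per_kernel n)); exact: measurable_funB.
- by move=> r _; rewrite lee_fin /jump ler_piMl ?per_kernel_ge0.
Qed.

(** The other side of [a] within [0, 1] is at positive distance from [t], and also
from [t] translated by [1] or [-1] because [t] is interior. *)
Lemma crossing_cvg t : 0 < t -> t < 1 -> t != a -> crossing n t @[n --> \oo] --> 0%E.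
Proof.
move=> t0 t1 ta.
(* If r lies in [0, 1] on the other side of a, then h <= |t - r| <= 1 - h. *)
pose h := Num.min (Num.min t (1 - t)) `|t - a|.
have h0 : 0 < h by rewrite !lt_min t0 subr_gt0 t1 normr_gt0 subr_eq0.
have ht : h <= t by rewrite !ge_min lexx.
have h1t : h <= 1 - t by rewrite !ge_min lexx orbT.
have hta : h <= `|t - a| by rewrite !ge_min lexx !orbT.
have [|b b0 Hb] := per_kernel_tail h0; first lra.
apply: (@squeeze_cvge _ _ _ _ (cst 0%E) _ (fun n => (`|b n|%R)%:E)).
- apply: nearW => n /=; rewrite crossing_ge0 /=.
  apply: (@le_trans _ _ (\int[leb]_(r in `[0%R, 1%R]) (`|b n|%R)%:E)%E).
    apply: ge0_le_integral => //.
    - by move=> r _; rewrite lee_fin jump_ge0.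
    - by apply: measurable_funTS; exact: mslice.
    move=> r /=; rewrite in_itv /= => /andP[r0 r1]; rewrite lee_fin /jump /=.
    rewrite !indicE !mem_setE !in_itv /= !andbT.
    have Hp : h <= `|t - r| -> per_kernel n (t - r) <= `|b n|.
      move=> hr; apply: (le_trans _ (ler_norm _)); apply: Hb => //.
      by rewrite ler_norml; apply/andP; split; lra.
    have [ra|ra] := ltP a r; have [at_|at_] := ltP a t;
      rewrite /= ?subrr ?normr0 ?mul0r ?subr0 ?sub0r ?normrN ?normr1 ?mul1r//.
    + apply: Hp; apply: (le_trans hta); rewrite ler0_norm ?ler0_norm; lra.
    + apply: Hp; apply: (le_trans hta); rewrite ger0_norm ?ger0_norm; lra.
  by rewrite integral_cst//= lebesgue_measure_itv /= lte01 sube0 mule1.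
- exact: cvg_cst.
- by apply: cvg_EFin; [exact: nearW|rewrite -(normr0 R); exact: cvg_norm].
Qed.

Lemma per_kernel_ray :
  vanishing (fun n => \int[leb]_(t in `[0%R, 1%R]) crossing n t)%E.
Proof.
apply: cvge0_vanishing.
have mD : measurable (`[0, 1]%classic : set R) by exact: measurable_itv.
have [] := @dominated_convergence _ _ R leb _ mD crossing (cst 0%E) (cst 1%E).
- by move=> n; apply: measurable_funTS; exact: measurable_crossing.
- exact: measurable_cst.
- exists ([set 0] `|` [set 1] `|` [set a]); split.
  + by apply: measurableU => //; exact: measurableU.
  + apply: null_set_setU => //; last exact: lebesgue_measure_set1.
      exact: measurableU.
    by apply: null_set_setU => //; exact: lebesgue_measure_set1.
  + move=> t; apply: contra_notP => /not_orP[/not_orP[t0 t1] ta] /=.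
    rewrite in_itv /= => /andP[t0' t1'].
    apply: crossing_cvg; rewrite ?lt_neqAle ?t0' ?t1' ?andbT; apply/eqP => //.
    by move=> e; apply: t0.
- apply/integrableP; split; first exact: measurable_cst.
  under eq_integral do rewrite /= normr1.
  by rewrite integral_cst//= lebesgue_measure_itv /= lte01 sube0 mule1 ltry.
- by apply/aeW => t n _; rewrite gee0_abs ?crossing_ge0 ?crossing_le1.
by move=> _ _; rewrite integral0.
Qed.

End ray.
End cos_kernel.

(** * Product integrals and the kernel on the torus *)

Section torus_integral.
Context (R : realType).
Local Notation leb := (@lebesgue_measure R).

Lemma ge0_integral_torus d (f : 'rV[R]_d -> \bar R) :
  measurable_fun setT f -> (forall x, 0 <= f x)%E ->
  (\int[@torus_measure R d]_x f x =
   \int[lebesgue_rV R d]_(x in @unit_cube R d) f x)%E.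
Proof.
move=> mf f0; have mC := @measurable_unit_cube R d.
rewrite (@ge0_negligible_integral _ _ _ (@torus_measure R d) setT (~` @unit_cube R d))//.
- rewrite setDE setTI setCK; apply: eq_measure_integral => A mA AC.
  by change (lebesgue_rV R d (A `&` @unit_cube R d) = lebesgue_rV R d A); rewrite setIidl.
- exact: measurableC.
- change (lebesgue_rV R d (~` @unit_cube R d `&` @unit_cube R d) = 0%E).
  by rewrite setICl measure0.
Qed.

(** Tonelli's theorem, one coordinate at a time. *)
Lemma ge0_integral_rV_prod n (h : 'I_n -> R -> R) :
  (forall i, measurable_fun setT (h i)) -> (forall i t, 0 <= h i t) ->
  (\int[lebesgue_rV R n]_x (\prod_i h i (x ord0 i))%:E =
   \prod_i \int[leb]_t (h i t)%:E)%E.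
Proof.
elim: n h => [|n IH] h mh h0.
  rewrite big_ord0; under eq_integral do rewrite big_ord0.
  by rewrite integral_cst// mul1e /= diracT.
have mprod m (g : 'I_m -> R -> R) : (forall i, measurable_fun setT (g i)) ->
    measurable_fun setT (fun x : 'rV[R]_m => \prod_i g i (x ord0 i)).
  move=> mg; apply: measurable_prod => i _.
  exact: (measurableT_comp (mg i) (@measurable_coor R m i)).
rewrite /= /lebesgue_rV_step ge0_integral_pushforward//; first last.
- by move=> x _; rewrite lee_fin prodr_ge0.
- by apply/measurable_EFinP; exact: mprod.
- exact: measurable_rV_cons.
rewrite preimage_setT big_ord_recl.
have E z : ((fun x : 'rV[R]_n.+1 => (\prod_i h i (x ord0 i))%:E) \o @rV_cons R n) z =
    ((h ord0 z.1)%:E * (\prod_i h (lift ord0 i) (z.2 ord0 i))%:E)%E.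
  rewrite /= big_ord_recl rV_cons0 EFinM; congr (_ * _%:E)%E.
  by apply: eq_bigr => i _; rewrite rV_consS.
under eq_integral do rewrite E.
have mt := mprod n _ (fun i => mh (lift ord0 i)).
rewrite fubini_tonelli1.
- rewrite /fubini_F /=.
  under eq_integral => x _.
    rewrite ge0_integralZl//; first last.
    - by rewrite lee_fin.
    - by move=> y _; rewrite lee_fin prodr_ge0.
    - exact/measurable_EFinP.
    rewrite (IH (fun i => h (lift ord0 i)))//.
    over.
  rewrite ge0_integralZr//.
  + by apply/measurable_EFinP; exact: mh.
  + by move=> x _; rewrite lee_fin.
  + by apply: prode_ge0 => i _; apply: integral_ge0 => t _; rewrite lee_fin.
- apply: emeasurable_funM; apply/measurable_EFinP.
    apply: (measurableT_comp (f := h ord0)); first exact: mh.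
    exact: measurable_fst.
  exact: (measurableT_comp mt measurable_snd).
- by move=> z; rewrite mule_ge0// lee_fin// prodr_ge0.
Qed.

Lemma ge0_integral_torus_prod d (h : 'I_d -> R -> R) :
  (forall i, measurable_fun setT (h i)) -> (forall i t, 0 <= h i t) ->
  (\int[@torus_measure R d]_x (\prod_i h i (x ord0 i))%:E =
   \prod_i \int[leb]_(t in `[0%R, 1%R]) (h i t)%:E)%E.
Proof.
move=> mh h0; pose I1 : set R := `[0, 1]%classic.
have mI : measurable_fun setT (\1_I1 : R -> R).
  by apply: measurable_indic; exact: measurable_itv.
rewrite ge0_integral_torus; first last.
- by move=> x; rewrite lee_fin prodr_ge0.
- apply/measurable_EFinP; apply: measurable_prod => i _.
  exact: (measurableT_comp (mh i) (@measurable_coor R d i)).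
transitivity (\int[lebesgue_rV R d]_x (\prod_i (h i (x ord0 i) * \1_I1 (x ord0 i)))%:E)%E.
  rewrite integral_mkcond; apply: eq_integral => x _; rewrite patchE; case: ifPn => xC.
    congr EFin; apply: eq_bigr => i _; rewrite indicE mem_set ?mulr1//.
    exact: (set_mem xC i).
  (* Outside of the cube some factor of the product is zero. *)
  have [i xi] : exists i, ~ (x ord0 i \in `[0, 1]).
    by apply/existsNP => H; move/negP: xC; apply; apply/mem_set => i; exact: H.
  by rewrite (bigD1 i)//= indicE memNset ?mulr0 ?mul0r.
rewrite (ge0_integral_rV_prod (h := fun i t => h i t * \1_I1 t)).
- apply: eq_bigr => i _; rewrite [RHS]integral_mkcond; apply: eq_integral => t _.
  by rewrite patchE indicE; case: ifP; rewrite ?mulr1 ?mulr0.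
- by move=> i; exact: measurable_funM.
- by move=> i t; rewrite mulr_ge0.
Qed.

Lemma ge0_integral_torus_coor d (i : 'I_d) (h : R -> R) :
  measurable_fun setT h -> (forall t, 0 <= h t) ->
  (\int[@torus_measure R d]_x (h (x ord0 i))%:E =
   \int[leb]_(t in `[0%R, 1%R]) (h t)%:E)%E.
Proof.
move=> mh h0; pose g j := if j == i then h else cst 1.
transitivity (\int[@torus_measure R d]_x (\prod_j g j (x ord0 j))%:E)%E.
  apply: eq_integral => x _; congr EFin.
  rewrite (bigD1 i)//= /g eqxx big1 ?mulr1// => j /negPf ->; by [].
rewrite ge0_integral_torus_prod.
- rewrite (bigD1 i)//= /g eqxx big1 ?mule1// => j /negPf ->.
  rewrite /= integral_cst//= lebesgue_measure_itv /= lte01 sube0 mule1; by [].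
- by move=> j; rewrite /g; case: ifP.
- by move=> j t; rewrite /g; case: ifP.
Qed.

End torus_integral.

Section torus_kernel.
Context (R : realType) (d : nat).
Local Notation leb := (@lebesgue_measure R).
Local Notation point := 'rV[R]_d.
Local Notation T := (@torus_measure R d).

Definition torus_kernel n (z : point * point) : R :=
  \prod_i per_kernel n (z.1 ord0 i - z.2 ord0 i).

Lemma torus_kernel_ge0 n z : 0 <= torus_kernel n z.
Proof. by apply: prodr_ge0 => i _; exact: per_kernel_ge0. Qed.

Lemma measurable_torus_kernel n : measurable_fun setT (torus_kernel n).
Proof.
apply: measurable_prod => i _; apply: (measurableT_comp (measurable_per_kernel n)).
have mi := @measurable_coor R d i.
by apply: measurable_funB; [exact: (measurableT_comp mi measurable_fst)|
  exact: (measurableT_comp mi measurable_snd)].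
Qed.

Let mshift n (u : R) : measurable_fun setT (fun t : R => per_kernel n (u - t)).
Proof. by apply: (measurableT_comp (measurable_per_kernel n)); exact: measurable_funB. Qed.

Lemma torus_kernel_snd n x : (\int[T]_y (torus_kernel n (x, y))%:E = 1)%E.
Proof.
rewrite /torus_kernel /= (ge0_integral_torus_prod (h := fun i t => per_kernel n (x ord0 i - t))).
- by apply: big1 => i _; exact: integral_per_kernel.
- by move=> i; exact: mshift.
- by move=> i t; exact: per_kernel_ge0.
Qed.

Lemma torus_kernel_fst n y : (\int[T]_x (torus_kernel n (x, y))%:E = 1)%E.
Proof.
rewrite -(torus_kernel_snd n y); apply: eq_integral => x _; congr EFin.
by apply: eq_bigr => i _ /=; rewrite -per_kernelN opprB.
Qed.

Let coor (i : 'I_d) (x : point) : R := x ord0 i.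

(** A half-space only involves the coordinate [i]. The other coordinates
integrate to [1], and the one-dimensional estimate remains. *)
Lemma torus_kernel_concentrates_ray (i : 'I_d) (a : R) :
  concentrates T torus_kernel (\1_(coor i @^-1` `]a, +oo[)).
Proof.
pose B : set R := `]a, +oo[%classic.
have mB : measurable_fun setT (\1_B : R -> R).
  by apply: measurable_indic; exact: measurable_itv.
have iE (x : point) : \1_(coor i @^-1` B) x = \1_B (x ord0 i) :> R.
  by rewrite !indicE; congr (_%:R); apply/idP/idP => /set_mem H; apply/mem_set.
apply: (vanishing_le _ (per_kernel_ray a)) => n.
have fE (x : point) : (\int[T]_y (`|\1_B (x ord0 i) - \1_B (y ord0 i)| * torus_kernel n (x, y))%:E =
    crossing a n (x ord0 i))%E.
  pose h j t := (if j == i then `|\1_B (x ord0 i) - \1_B t| else 1) *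
    per_kernel n (x ord0 j - t).
  transitivity (\int[T]_y (\prod_j h j (y ord0 j))%:E)%E.
    apply: eq_integral => y _; rewrite /h big_split /=; congr (_ * _)%:E.
    by rewrite (bigD1 i)//= eqxx big1 ?mulr1// => j /negPf ->.
  rewrite ge0_integral_torus_prod.
  - rewrite (bigD1 i)//= big1 ?mule1.
      by apply: eq_integral => t _; rewrite /h eqxx.
    move=> j /negPf ji; rewrite -[RHS](integral_per_kernel n (x ord0 j)).
    by apply: eq_integral => t _; rewrite /h ji mul1r.
  - move=> j; rewrite /h; apply: measurable_funM; last exact: mshift.
    case: (j == i); last exact: measurable_cst.
    by apply: measurableT_comp => //; apply: measurable_funB.
  - move=> j t; rewrite /h mulr_ge0 ?per_kernel_ge0//; by case: ifP.
have cfin t : (crossing a n t = (fine (crossing a n t))%:E)%E.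
  rewrite fineK// ge0_fin_numE ?crossing_ge0//.
  by rewrite (le_lt_trans (crossing_le1 a n t)) ?ltry.
rewrite le_eqVlt; apply/orP; left; apply/eqP; rewrite /osc /avg fubini_tonelli1.
- rewrite (_ : fubini_F _ _ = fun x : point => (fine (crossing a n (x ord0 i)))%:E); last first.
    apply/funext => x; rewrite -cfin -fE; apply: eq_integral => y _.
    by rewrite !iE.
  rewrite (ge0_integral_torus_coor i (h := fun t => fine (crossing a n t))).
  + by apply: eq_integral => t _; rewrite -cfin.
  + apply: (measurableT_comp (f := @fine R)); last exact: measurable_crossing.
    exact: fine_measurable.
  + by move=> t; apply: fine_ge0; exact: crossing_ge0.
- apply/measurable_EFinP/measurable_funM; last exact: measurable_torus_kernel.
  apply: measurable_osc; rewrite (_ : \1_ _ = fun x : point => \1_B (x ord0 i) : R);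
    last exact/funext.
  exact: (measurableT_comp mB (@measurable_coor R d i)).
- by move=> z; rewrite lee_fin mulr_ge0 ?torus_kernel_ge0.
Qed.

(** Half-spaces generate the measurable sets. *)
Lemma torus_kernel_concentrates A : measurable A ->
  concentrates T torus_kernel (\1_A).
Proof.
have SA : sigma_algebra setT [set A | measurable A /\ concentrates T torus_kernel (\1_A)].
  apply: sigma_algebra_concentrates.
  - exact: measurable_torus_kernel.
  - exact: torus_kernel_ge0.
  - exact: torus_kernel_snd.
  - exact: torus_kernel_fst.
move=> mA.
suff /(_ A mA) [] : measurable `<=`
  [set A | measurable A /\ concentrates T torus_kernel (\1_A)] by [].
apply: smallest_sub => // B; rewrite -bigcup_seq /= => -[i _ [Y mY <-]].
rewrite setTI.
suff : (@RGenOInfty.G R).-sigma.-measurable `<=` image_set_system setT (coor i)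
    [set A | measurable A /\ concentrates T torus_kernel (\1_A)].
  by rewrite -RGenOInfty.measurableE => /(_ Y mY); rewrite /image_set_system /= setTI.
apply: smallest_sub.
  exact: sigma_algebra_image.
move=> _ [a ->]; rewrite /image_set_system /= setTI; split.
  rewrite -[X in measurable X]setTI; apply: measurable_coor => //.
exact: torus_kernel_concentrates_ray.
Qed.

End torus_kernel.

(** * Trigonometric polynomials *)

Section trig_polynomials.
Context (R : realType) (d : nat).
Local Notation point := 'rV[R]_d.

(** A class of test functions that contains the factors of the kernel. Because it
is closed under directional derivatives ([trig_poly_derive]), smoothness of every
order is an immediate induction, without a Leibniz rule for [Ck]. *)
Inductive trig_poly : (point -> R) -> Prop :=
| trig_cst c : trig_poly (cst c)
| trig_cos i : trig_poly (fun x => cos (pi *+ 2 * x ord0 i))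
| trig_sin i : trig_poly (fun x => sin (pi *+ 2 * x ord0 i))
| trig_add f g : trig_poly f -> trig_poly g -> trig_poly (f \+ g)
| trig_mul f g : trig_poly f -> trig_poly g -> trig_poly (f \* g).

Lemma trig_poly_periodic f : trig_poly f -> zperiodic f.
Proof.
have per (g : R -> R) : periodic g (pi *+ 2) -> forall (i : 'I_d) x (k : 'rV[int]_d),
    g (pi *+ 2 * (x + map_mx intr k) ord0 i) = g (pi *+ 2 * x ord0 i).
  move=> gper i x k; rewrite !mxE; case: (k ord0 i) => n.
    by rewrite mulrDr -pmulrn mulr_natr; exact: periodicn.
  rewrite NegzE mulrNz -(periodicn gper n.+1) mulrDr mulrN -addrA.
  by rewrite -[in X in _ + X]pmulrn mulr_natr addNr addr0.
elim=> [//|i x k|i x k|{}f g _ fper _ gper x k|{}f g _ fper _ gper x k].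
- exact: (per cos (@cosD2pi R)).
- exact: (per sin (@sinD2pi R)).
- by rewrite /= fper gper.
- by rewrite /= fper gper.
Qed.

Lemma trig_poly_measurable f : trig_poly f -> measurable_fun setT f.
Proof.
have mc (i : 'I_d) : measurable_fun setT (fun x : point => pi *+ 2 * x ord0 i).
  by apply: measurable_funM => //; exact: measurable_coor.
elim=> [c|i|i|{}f g _ mf _ mg|{}f g _ mf _ mg].
- exact: measurable_cst.
- apply: (measurableT_comp (f := @cos R)); last exact: mc.
  exact: continuous_measurable_fun (@continuous_cos R).
- apply: (measurableT_comp (f := @sin R)); last exact: mc.
  exact: continuous_measurable_fun (@continuous_sin R).
- exact: measurable_funD.
- exact: measurable_funM.
Qed.

Lemma trig_poly_bounded f : trig_poly f -> exists M, forall x, `|f x| <= M.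
Proof.
elim=> [c|i|i|{}f g _ [M HM] _ [N HN]|{}f g _ [M HM] _ [N HN]].
- by exists `|c|.
- by exists 1 => x; exact: cos_max.
- by exists 1 => x; exact: sin_max.
- exists (M + N) => x; exact: le_trans (ler_normD _ _) (lerD (HM x) (HN x)).
- by exists (M * N) => x; rewrite normrM ler_pM.
Qed.

Lemma is_derive_coor (i : 'I_d) (x v : point) :
  is_derive x v (fun y : point => y ord0 i) (v ord0 i).
Proof.
have dc := differentiable_coord x ord0 i.
apply: DeriveDef; first exact: diff_derivable.
rewrite /derive; apply: cvg_lim => //; apply: cvg_near_cst.
near=> h; rewrite /= !mxE addrK -[_ *: _]/(h^-1 * (h * v ord0 i)) mulrA mulVf ?mul1r//.
by near: h; exact: nbhs_dnbhs_neq.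
Unshelve. all: by end_near. Qed.

Lemma is_derive_comp_coor (g : R -> R) (i : 'I_d) (x v : point) (dg : R) :
  is_derive (pi *+ 2 * x ord0 i) 1 g dg ->
  differentiable (fun y : point => g (pi *+ 2 * y ord0 i)) x /\
  'D_v (fun y : point => g (pi *+ 2 * y ord0 i)) x = pi *+ 2 * v ord0 i * dg.
Proof.
move=> [+ gE] => /derivable1_diffP dg0.
pose l (y : point) : R := pi *+ 2 * y ord0 i.
have dl : differentiable l x.
  apply: (@differentiableM _ _ (cst (pi *+ 2)) (fun y : point => y ord0 i)).
    exact: differentiable_cst.
  exact: differentiable_coord.
have Dl : 'D_v l x = pi *+ 2 * v ord0 i.
  exact: (@derive_val _ _ _ _ _ _ _ (is_deriveZ (pi *+ 2 : R) (is_derive_coor i x v))).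
have dgl : differentiable (g \o l) x by exact: differentiable_comp.
split => //; rewrite -[LHS]/('D_v (g \o l) x) deriveE// diff_comp//=.
have -> : 'd l x v = pi *+ 2 * v ord0 i by rewrite -(deriveE _ dl).
by rewrite -gE deriveE// -[X in 'd _ _ X]mulr1 -[_ * 1]/(_ *: _) linearZ.
Qed.

Lemma trig_poly_derive f : trig_poly f ->
  (forall x, differentiable f x) /\ (forall v, trig_poly ('D_v f)).
Proof.
elim=> [c|i|i|{}f g Tf [df Df] Tg [dg Dg]|{}f g Tf [df Df] Tg [dg Dg]].
- split=> [x|v]; first exact: differentiable_cst.
  rewrite (_ : 'D_v _ = cst 0); first exact: trig_cst.
  by apply/funext => x; exact: derive_cst.
- have H v (x : point) := is_derive_comp_coor v (is_derive_cos (pi *+ 2 * x ord0 i)).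
  split=> [x|v]; first by have [] := H 0 x.
  rewrite (_ : 'D_v _ = cst (pi *+ 2 * v ord0 i * -1) \*
      (fun x => sin (pi *+ 2 * x ord0 i))).
    by apply: trig_mul; [exact: trig_cst|exact: trig_sin].
  by apply/funext => x; rewrite (H v x).2 /=; ring.
- have H v (x : point) := is_derive_comp_coor v (is_derive_sin (pi *+ 2 * x ord0 i)).
  split=> [x|v]; first by have [] := H 0 x.
  rewrite (_ : 'D_v _ = cst (pi *+ 2 * v ord0 i) \*
      (fun x => cos (pi *+ 2 * x ord0 i))).
    by apply: trig_mul; [exact: trig_cst|exact: trig_cos].
  by apply/funext => x; rewrite (H v x).2.
- split=> [x|v]; first exact: differentiableD.
  rewrite (_ : 'D_v _ = 'D_v f \+ 'D_v g); first exact: trig_add.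
  by apply/funext => x; apply: deriveD; exact: diff_derivable.
- split=> [x|v]; first exact: differentiableM.
  rewrite (_ : 'D_v _ = (f \* 'D_v g) \+ (g \* 'D_v f)).
    by apply: trig_add; exact: trig_mul.
  by apply/funext => x; apply: deriveM; exact: diff_derivable.
Qed.

Lemma trig_poly_test f : trig_poly f -> test_function f.
Proof.
move=> Tf; split; first exact: trig_poly_periodic.
move=> k; elim: k f Tf => [|k IH] f Tf /=.
  by move=> x; apply: differentiable_continuous; exact: (trig_poly_derive Tf).1.
have [df Df] := trig_poly_derive Tf; split => // v; exact: IH.
Qed.

End trig_polynomials.

(** * Separability of the kernel *)

Section integral_bigsum.
Context d (T : measurableType d) (R : realType) (mu : {measure set T -> \bar R}).
Variables (I : Type) (F : I -> T -> R).
Hypothesis iF : forall k, mu.-integrable setT (EFin \o F k).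

Lemma integrable_bigsum (r : seq I) :
  mu.-integrable setT (EFin \o (fun x => \sum_(k <- r) F k x)).
Proof.
elim: r => [|k r IH].
  by under eq_fun do rewrite big_nil; exact: integrable0.
under eq_fun do rewrite big_cons; exact: (integrableD measurableT (iF k) IH).
Qed.

Lemma Rintegral_bigsum (r : seq I) :
  (\int[mu]_x (\sum_(k <- r) F k x) = \sum_(k <- r) \int[mu]_x F k x)%R.
Proof.
elim: r => [|k r IH].
  under [LHS]eq_Rintegral do rewrite big_nil.
  by rewrite big_nil Rintegral_cst// mul0r.
under [LHS]eq_Rintegral do rewrite big_cons.
by rewrite big_cons RintegralD// ?IH//; exact: integrable_bigsum.
Qed.

End integral_bigsum.

Section tensor.
Context d (T : measurableType d) (R : realType) (mu : probability T R).
Local Notation m2 := (mu \x mu)%E.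

Lemma tensor_integrable (f g : T -> R) : mu.-integrable setT (EFin \o f) ->
  mu.-integrable setT (EFin \o g) ->
  m2.-integrable setT (EFin \o (fun z => f z.1 * g z.2)).
Proof.
move=> intf intg.
have mf : measurable_fun setT f by apply/measurable_EFinP; exact: measurable_int intf.
have mg : measurable_fun setT g by apply/measurable_EFinP; exact: measurable_int intg.
have mfg : measurable_fun setT (EFin \o (fun z : T * T => f z.1 * g z.2)).
  apply/measurable_EFinP/measurable_funM.
    exact: (measurableT_comp mf measurable_fst).
  exact: (measurableT_comp mg measurable_snd).
apply/integrable12ltyP => //=.
have /integrableP[_ fy] := intf; have /integrableP[_ gy] := intg.
under eq_integral => x _.
  under eq_integral do rewrite normrM EFinM.
  rewrite ge0_integralZl//; last first.
    by apply/measurable_EFinP; exact: measurableT_comp.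
  over.
rewrite /= ge0_integralZr//; first last.
- exact: integral_ge0.
- by apply/measurable_EFinP; exact: measurableT_comp.
by apply: lte_mul_pinfty => //; [exact: integral_ge0|rewrite ge0_fin_numE//; exact: integral_ge0].
Qed.

Lemma tensor_integral (f g : T -> R) : mu.-integrable setT (EFin \o f) ->
  mu.-integrable setT (EFin \o g) ->
  (\int[m2]_z (f z.1 * g z.2) = (\int[mu]_x f x) * (\int[mu]_y g y))%R.
Proof.
move=> intf intg; rewrite /Rintegral -(integral12_prod_meas1 (tensor_integrable intf intg)).
rewrite /fubini_F /=.
under eq_integral => x _.
  under eq_integral do rewrite EFinM.
  rewrite integralZl//.
  over.
rewrite /=.
have gfin := integrable_fin_num measurableT intg.
rewrite /= in gfin.
have -> : (\int[mu]_x ((f x)%:E * \int[mu]_x0 (g x0)%:E) =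
    \int[mu]_x (f x)%:E * \int[mu]_x (g x)%:E)%E.
  by rewrite -[in LHS](fineK gfin) integralZr// fineK.
by rewrite fineM//; exact: (integrable_fin_num measurableT intf).
Qed.

Lemma tensor_sumE (I : Type) (r : seq I) (v w : T -> R) (a b : I -> T -> R) :
  (fun z : T * T => v z.1 * w z.2 * \sum_(k <- r) a k z.1 * b k z.2) =
  (fun z => \sum_(k <- r) (v z.1 * a k z.1) * (w z.2 * b k z.2)).
Proof.
by apply/funext => z; rewrite mulr_sumr; apply: eq_bigr => k _; ring.
Qed.

Lemma tensor_sum_integrable (I : Type) (r : seq I) (v w : T -> R) (a b : I -> T -> R) :
  (forall k, mu.-integrable setT (EFin \o (fun x => v x * a k x))) ->
  (forall k, mu.-integrable setT (EFin \o (fun x => w x * b k x))) ->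
  m2.-integrable setT
    (EFin \o (fun z => v z.1 * w z.2 * \sum_(k <- r) a k z.1 * b k z.2)).
Proof.
move=> iv iw; rewrite tensor_sumE; apply: integrable_bigsum => k.
exact: (tensor_integrable (iv k) (iw k)).
Qed.

Lemma tensor_sum_integral (I : Type) (r : seq I) (v w : T -> R) (a b : I -> T -> R) :
  (forall k, mu.-integrable setT (EFin \o (fun x => v x * a k x))) ->
  (forall k, mu.-integrable setT (EFin \o (fun x => w x * b k x))) ->
  (\int[m2]_z (v z.1 * w z.2 * \sum_(k <- r) a k z.1 * b k z.2) =
   \sum_(k <- r) (\int[mu]_x (v x * a k x)) * (\int[mu]_y (w y * b k y)))%R.
Proof.
move=> iv iw; rewrite tensor_sumE Rintegral_bigsum.
  by apply: eq_bigr => k _; rewrite (tensor_integral (iv k) (iw k)).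
by move=> k; exact: (tensor_integrable (iv k) (iw k)).
Qed.

End tensor.

Section separable.
Context (R : realType) (d : nat).
Local Notation point := 'rV[R]_d.

Definition separable (K : point -> point -> R) : Prop :=
  exists (I : finType) (a b : I -> point -> R),
    [/\ forall k, trig_poly (a k), forall k, trig_poly (b k) &
        forall x y, K x y = \sum_k a k x * b k y].

Lemma separable1 (f g : point -> R) : trig_poly f -> trig_poly g ->
  separable (fun x y => f x * g y).
Proof.
move=> Tf Tg; exists 'I_1, (fun=> f), (fun=> g); split => // x y.
by rewrite big_ord1.
Qed.

Lemma separableD K L : separable K -> separable L ->
  separable (fun x y => K x y + L x y).
Proof.
move=> [I [a [b [Ta Tb E]]]] [J [a' [b' [Ta' Tb' E']]]].
exists (I + J)%type, (fun k => match k with inl i => a i | inr j => a' j end),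
  (fun k => match k with inl i => b i | inr j => b' j end).
by split => [[]|[]|x y] //; rewrite E E' big_sumType.
Qed.

Lemma separableM K L : separable K -> separable L ->
  separable (fun x y => K x y * L x y).
Proof.
move=> [I [a [b [Ta Tb E]]]] [J [a' [b' [Ta' Tb' E']]]].
exists (I * J)%type, (fun k => a k.1 \* a' k.2), (fun k => b k.1 \* b' k.2).
split => [k|k|x y]; [exact: trig_mul|exact: trig_mul|].
rewrite E E' mulr_suml.
rewrite -(pair_big xpredT xpredT (fun i j => a i x * a' j x * (b i y * b' j y))) /=.
apply: eq_bigr => i _; rewrite mulr_sumr; apply: eq_bigr => j _; ring.
Qed.

Lemma separable_cst c : separable (fun _ _ => c).
Proof.
have := separable1 (trig_cst d c) (trig_cst d 1).
congr separable; apply/funext => x; apply/funext => y; exact: mulr1.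
Qed.

(** The addition formula
[2 cos^2 (pi (x - y)) = 1 + cos (2 pi x) cos (2 pi y) + sin (2 pi x) sin (2 pi y)]
separates the variables; sums and products preserve separability. *)
Lemma separable_torus_kernel n :
  separable (fun x y : point => torus_kernel n (x, y)).
Proof.
suff H i : separable (fun x y : point => per_kernel n (x ord0 i - y ord0 i)).
  rewrite /torus_kernel /=; elim: (index_enum _) => [|i r IH].
    have := separable_cst 1; congr separable.
    by apply/funext => x; apply/funext => y; rewrite big_nil.
  have := separableM (H i) IH; congr separable.
  by apply/funext => x; apply/funext => y; rewrite big_cons.
apply: (separableM _ (separable_cst _)).
have H2 : separable (fun x y : point => cos (pi * (x ord0 i - y ord0 i)) ^+ 2).
  have := separableM (separableD (separable_cst 1)
    (separableD (separable1 (trig_cos R i) (trig_cos R i))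
                (separable1 (trig_sin R i) (trig_sin R i)))) (separable_cst 2^-1).
  congr separable; apply/funext => x; apply/funext => y.
  by rewrite -cosB -mulrBr mulrnAl cos_mulr2n; field.
have -> : (fun x y : point => cosX n (x ord0 i - y ord0 i)) =
    (fun x y => (cos (pi * (x ord0 i - y ord0 i)) ^+ 2) ^+ n).
  by apply/funext => x; apply/funext => y; rewrite /cosX -mul2n exprM.
elim: n => [|n IH]; first exact: separable_cst.
have := separableM H2 IH; congr separable.
by apply/funext => x; apply/funext => y; rewrite -exprS.
Qed.

Lemma is_derive_bigsum (I : Type) (r : seq I) (h : I -> point -> R) (dh : I -> R)
    (x v : point) : (forall i, is_derive x v (h i) (dh i)) ->
  is_derive x v (fun y => \sum_(i <- r) h i y) (\sum_(i <- r) dh i).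
Proof.
move=> H; elim: r => [|i r IH].
  rewrite big_nil; under eq_fun do rewrite big_nil; exact: is_derive_cst.
rewrite big_cons; under eq_fun do rewrite big_cons.
exact: is_deriveD.
Qed.

Lemma trig_poly_is_derive (f : point -> R) x v : trig_poly f ->
  is_derive x v f ('D_v f x).
Proof.
by move=> /trig_poly_derive[df _]; apply: DeriveDef => //; exact: diff_derivable.
Qed.

End separable.

(** * Regularizing the divergence-free condition *)

Section testing.
Context (R : realType) (d : nat).
Local Notation point := 'rV[R]_d.
Local Notation T := (@torus_measure R d).
Local Notation m2 := (T \x T)%E.
Local Notation e_ i := (delta_mx ord0 i : point).

Lemma Lp_torus_integrable (p : R) (g : point -> R) : 1 < p -> Lp_torus p g ->
  T.-integrable setT (EFin \o g).
Proof.
move=> p1 [_ gp]; apply/Lfun1_integrable; apply: Lfun_subset gp.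
- exact: lexx.
- by rewrite lee_fin ltW.
- exact: fin_num_measure.
- by rewrite lee_fin ltW.
Qed.

Lemma trig_poly_integrable (v f : point -> R) : T.-integrable setT (EFin \o v) ->
  trig_poly f -> T.-integrable setT (EFin \o (fun x => v x * f x)).
Proof.
move=> iv Tf; have [M HM] := trig_poly_bounded Tf.
have mf := trig_poly_measurable Tf.
have mv : measurable_fun setT v by apply/measurable_EFinP; exact: measurable_int iv.
apply: (@le_integrable _ _ _ _ setT _ _ (fun x => M%:E * (v x)%:E)%E) => //.
- by apply/measurable_EFinP; exact: measurable_funM.
- move=> x _; rewrite /= lee_fin !normrM mulrC ler_wpM2r//.
  exact: le_trans (HM x) (ler_norm M).
- exact: (integrableZl measurableT M iv).
Qed.

Lemma torus_kernel_shift n (x y w : point) :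
  torus_kernel n (x + w, y + w) = torus_kernel n (x, y).
Proof.
apply: eq_bigr => i _ /=; rewrite !mxE; congr per_kernel; ring.
Qed.

(** Summation by parts: [Du] against [b_k] is minus [u] against the derivative of
[b_k]; inside the sum over [k] that derivative can be exchanged for minus the
derivative of [a_k]; and [V] is orthogonal to the gradient of each [a_k]. *)
Lemma torus_kernel_test_sum n (V Du : point -> point) (u : point -> R) :
  (forall i, T.-integrable setT (EFin \o (fun x => V x ord0 i))) ->
  (forall i, T.-integrable setT (EFin \o (fun x => Du x ord0 i))) ->
  T.-integrable setT (EFin \o u) ->
  weak_gradient u Du -> weakly_divergence_free V ->
  \sum_(i < d) (\int[m2]_z (V z.1 ord0 i * Du z.2 ord0 i * torus_kernel n z))%R = 0.
Proof.
move=> iV iD iu wg df.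
have [I [a [b [Ta Tb E]]]] := @separable_torus_kernel R d n.
have KE z : torus_kernel n z = \sum_k a k z.1 * b k z.2 by case: z => x y; exact: E.
have Tda k i : trig_poly ('D_(e_ i) (a k)) by exact: (trig_poly_derive (Ta k)).2.
have Tdb k i : trig_poly ('D_(e_ i) (b k)) by exact: (trig_poly_derive (Tb k)).2.
have swap i x y : \sum_k a k x * 'D_(e_ i) (b k) y =
    - (\sum_k 'D_(e_ i) (a k) x * b k y).
  have dx v : is_derive x v (fun x' => torus_kernel n (x', y))
      (\sum_k 'D_v (a k) x * b k y).
    have -> : (fun x' => torus_kernel n (x', y)) = (fun x' => \sum_k b k y * a k x').
      by apply/funext => x'; rewrite E; apply: eq_bigr => k _; rewrite mulrC.
    under eq_bigr do rewrite mulrC.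
    by apply: is_derive_bigsum => k; apply: is_deriveZ; exact: trig_poly_is_derive.
  have dy : is_derive y (e_ i) (fun y' => torus_kernel n (x, y'))
      (\sum_k a k x * 'D_(e_ i) (b k) y).
    have -> : (fun y' => torus_kernel n (x, y')) = (fun y' => \sum_k a k x * b k y').
      by apply/funext => y'; rewrite E.
    by apply: is_derive_bigsum => k; apply: is_deriveZ; exact: trig_poly_is_derive.
  (* Moving y by h e_i amounts to moving x by - h e_i. *)
  transitivity ('D_(- e_ i) (fun x' => torus_kernel n (x', y)) x).
    rewrite -(@derive_val _ _ _ _ _ _ _ dy) /derive.
    apply: (congr1 (fun g : R -> R => lim (g @ 0^'))).
    apply/funext => h /=; congr (_ *: (_ - _)).
    rewrite -(torus_kernel_shift n _ _ (- (h *: e_ i))).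
    by congr torus_kernel; congr pair; [rewrite scalerN addrC|rewrite addrAC subrr add0r].
  rewrite (@derive_val _ _ _ _ _ _ _ (dx (- e_ i))) -sumrN; apply: eq_bigr => k _.
  have dak := (trig_poly_derive (Ta k)).1 x.
  by rewrite !deriveE// linearN mulNr.
transitivity (\sum_(i < d) \sum_k
    (\int[T]_x (V x ord0 i * a k x))%R * (\int[T]_y (Du y ord0 i * b k y))%R).
  apply: eq_bigr => i _; under eq_Rintegral do rewrite KE.
  apply: (@tensor_sum_integral _ _ _ T I _ (fun x => V x ord0 i) (fun x => Du x ord0 i) a b) => k;
    exact: trig_poly_integrable.
transitivity (\sum_(i < d) \sum_k
    (\int[T]_x (V x ord0 i * 'D_(e_ i) (a k) x))%R * (\int[T]_y (u y * b k y))%R).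
  apply: eq_bigr => i _.
  transitivity (- \sum_k (\int[T]_x (V x ord0 i * a k x))%R *
      (\int[T]_y (u y * 'D_(e_ i) (b k) y))%R).
    rewrite -sumrN; apply: eq_bigr => k _; rewrite -mulrN; congr (_ * _).
    have := wg _ (trig_poly_test (Tb k)) i.
    under [X in X = _ -> _]eq_Rintegral do rewrite mxE.
    by move=> ->; rewrite opprK.
  rewrite -(@tensor_sum_integral _ _ _ T I _ (fun x => V x ord0 i) u a
    (fun k => 'D_(e_ i) (b k))); first last.
  - by move=> k; exact: trig_poly_integrable.
  - by move=> k; exact: trig_poly_integrable.
  rewrite -(@tensor_sum_integral _ _ _ T I _ (fun x => V x ord0 i) u
    (fun k => 'D_(e_ i) (a k)) b); first last.
  - by move=> k; exact: trig_poly_integrable.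
  - by move=> k; exact: trig_poly_integrable.
  under eq_Rintegral do rewrite swap mulrN -mulN1r.
  rewrite RintegralZl// ?mulN1r ?opprK//.
  by apply: (@tensor_sum_integrable _ _ _ T I _ (fun x => V x ord0 i) u
    (fun k => 'D_(e_ i) (a k)) b) => k;
    exact: trig_poly_integrable.
rewrite exchange_big /= big1// => k _; rewrite -mulr_suml.
have := df _ (trig_poly_test (Ta k)).
rewrite /dotp Rintegral_bigsum => [df0|].
  rewrite (_ : \sum_(i < d) _ = 0) ?mul0r// -[RHS]df0.
  by apply: eq_bigr => i _; under [RHS]eq_Rintegral do rewrite mxE.
move=> i; under eq_fun do rewrite mxE.
exact: trig_poly_integrable.
Qed.

End testing.

(** * Orthogonality and strict convexity *)

Section orthogonality.
Context (R : realType) (d : nat).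
Local Notation point := 'rV[R]_d.
Local Notation T := (@torus_measure R d).
Local Notation m2 := (T \x T)%E.

Lemma conjugate_gt1 (s s' : R) : 1 < s -> s^-1 + s'^-1 = 1 -> 1 < s'.
Proof.
move=> s1 ss; have s0 := lt_trans ltr01 s1.
have E : s'^-1 = 1 - s^-1 by rewrite -ss addrC addKr.
have p0 : 0 < s'^-1 by rewrite E subr_gt0 invf_lt1.
have : s'^-1 < 1 by rewrite E ltrBlDr ltrDl invr_gt0.
by rewrite invf_lt1// -invr_gt0.
Qed.

Lemma Lp_torus_mul_integrable (p q : R) (V W : point -> R) : 1 < p -> 1 < q ->
  p^-1 + q^-1 = 1 -> Lp_torus p V -> Lp_torus q W ->
  T.-integrable setT (EFin \o (fun x => V x * W x)).
Proof.
move=> p1 q1 pq [_ LV] [_ LW].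
have [D _ HD] := young_weighted p1 q1 pq ltr01.
have iV := Lfun_integrable (ltW p1) LV.
have iW := Lfun_integrable (ltW q1) LW.
have mV : measurable_fun setT V by have /sub_Lfun_mfun /set_mem := LV.
have mW : measurable_fun setT W by have /sub_Lfun_mfun /set_mem := LW.
apply: (le_integrable _ _ _ (integrableD measurableT
  (integrableZl measurableT D iV) iW)) => //.
  by apply/measurable_EFinP; exact: measurable_funM.
move=> x _; rewrite lee_fin normrM.
by apply: (le_trans _ (ler_norm _)); rewrite -[X in _ + X]mul1r; exact: HD.
Qed.

(** The regularized integrals are all zero and converge to the integral of
[V . Du]. *)
Lemma div_free_orthogonal (s s' : R) (u : point -> R) (V Du : point -> point) :
  1 < s -> s^-1 + s'^-1 = 1 -> sobolev s u Du -> Lp_torus_vec s' V ->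
  weakly_divergence_free V ->
  (\int[T]_x dotp (V x) (Du x))%R = 0.
Proof.
move=> s1 ss [Lu LD wg] LV df.
have s1' := conjugate_gt1 s1 ss; have ss' : s'^-1 + s^-1 = 1 by rewrite addrC.
rewrite /dotp Rintegral_bigsum; last first.
  by move=> i; exact: (Lp_torus_mul_integrable s1' s1 ss' (LV i) (LD i)).
have H i := @avg_mul_cvg _ _ R T (@torus_kernel R d)
  (@measurable_torus_kernel R d) (@torus_kernel_ge0 R d)
  (@torus_kernel_snd R d) (@torus_kernel_fst R d)
  (@torus_kernel_concentrates R d) s' s (fun x => V x ord0 i) (fun x => Du x ord0 i)
  s1' s1 ss' (LV i).2 (LD i).2.
have C (r : seq 'I_d) : (fun n => \sum_(i <- r)
    (\int[m2]_z (V z.1 ord0 i * Du z.2 ord0 i * torus_kernel n z))%R) @ \oo -->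
    \sum_(i <- r) (\int[T]_x (V x ord0 i * Du x ord0 i))%R.
  elim: r => [|i r IH].
    by under eq_fun do rewrite big_nil; rewrite big_nil; exact: cvg_cst.
  under eq_fun do rewrite big_cons; rewrite big_cons; exact: cvgD (H i) IH.
have {}C := C (index_enum _).
have Z : (fun n => \sum_(i < d)
    (\int[m2]_z (V z.1 ord0 i * Du z.2 ord0 i * torus_kernel n z))%R) = (fun=> 0).
  apply/funext => n; apply: torus_kernel_test_sum wg df.
  - by move=> i; exact: Lp_torus_integrable (LV i).
  - by move=> i; exact: Lp_torus_integrable (LD i).
  - exact: Lp_torus_integrable Lu.
rewrite Z in C; apply: (cvg_unique _ C); first exact: Rhausdorff.
exact: cvg_cst.
Qed.

End orthogonality.

Section convexity.
Context (R : realType) (d : nat).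
Local Notation point := 'rV[R]_d.
Implicit Types (g : point -> R) (p : point).

Lemma dotp_gradient g p v : differentiable g p -> dotp (gradient g p) v = 'D_v g p.
Proof.
move=> dg; rewrite deriveE// {2}(row_sum_delta v) linear_sum /dotp.
by apply: eq_bigr => i _; rewrite linearZ /= mxE deriveE// mulrC.
Qed.

Lemma dotp0 (v : point) : dotp v 0 = 0.
Proof. by rewrite /dotp big1// => i _; rewrite mxE mulr0. Qed.

(** Strict convexity makes the minimum at [0] strict, and along the segment from
[0] to [p] the slope at [p] is at least the mean slope [g p - g 0]. *)
Lemma convex_gradient_gt0 g p : strictly_convex g -> (forall y, g 0 <= g y) ->
  differentiable g p -> p != 0 -> 0 < dotp (gradient g p) p.
Proof.
move=> cg g0 dg p0; rewrite dotp_gradient//.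
have gp : g 0 < g p.
  have h1 : (2^-1 : R) < 1 by rewrite invf_lt1// ltr1n.
  have := cg p 0 2^-1 p0 _ h1; rewrite invr_gt0 ltr0n => /(_ isT).
  move=> /(le_lt_trans (g0 _)); lra.
apply: (@lt_le_trans _ _ (g p - g 0)); first by rewrite subr_gt0.
have := diff_derivable (v := p) dg; rewrite /derivable => /cvg_dnbhs_at_left cD.
apply: (cvgr_to_ge cD); near=> h.
have h0 : h < 0 by near: h; exact: nbhs_left_lt.
have h1 : -1 < h by near: h; apply: nbhs_left_gt; rewrite oppr_lt0.
have hp : 0 < 1 + h by rewrite -ltrBlDl sub0r.
have hq : 1 + h < 1 by rewrite gtrDl.
have := cg p 0 (1 + h) p0 hp hq.
rewrite scaler0 addr0 scalerDl scale1r [p + _]addrC => H.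
rewrite /= -[_ *: _]/(_ * _) mulrC ler_ndivlMr//.
rewrite mulrBl; nra.
Unshelve. all: by end_near. Qed.

End convexity.

(** * The gap set *)

Section continuity.
Context (R : realType) (d : nat).
Local Notation point := 'rV[R]_d.

Lemma C1_differentiable_slice (H : point -> point -> R) :
  Ck 1 (fun z : point * point => H z.1 z.2) -> forall x p, differentiable (H x) p.
Proof.
move=> [dH _] x p.
apply: (@differentiable_comp _ _ _ _ (fun p => (x, p)) (fun z : point * point => H z.1 z.2)).
  by apply: differentiable_pair => //; exact: differentiable_cst.
exact: dH.
Qed.

Lemma C1_continuous_slice (H : point -> point -> R) :
  Ck 1 (fun z : point * point => H z.1 z.2) -> continuous (H^~ 0).
Proof.
move=> [dH _] x.
have dH0 : differentiable (H^~ 0) x.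
  apply: (@differentiable_comp _ _ _ _ (fun x => (x, 0 : point))
    (fun z : point * point => H z.1 z.2)).
    by apply: differentiable_pair => //; exact: differentiable_cst.
  exact: dH.
exact: differentiable_continuous dH0.
Qed.

Lemma within_continuous_slice (f : point -> R -> R) :
  {within [set z : point * R | 0 <= z.2],
     continuous (fun z : point * R => f z.1 z.2)} ->
  continuous (f^~ 0).
Proof.
move=> /subspace_continuousP cf x.
have fx := cf (x, 0) (lexx 0).
apply: (@cvg_comp _ _ _ (fun y : point => (y, 0 : R)) (fun z => f z.1 z.2) _ _ _ _ fx).
move=> B [[B1 B2] /= [nB1 nB2] HB]; apply: filterS nB1 => y B1y.
by apply: (HB (y, 0)) => //=; split => //; exact: nbhs_singleton nB2.
Qed.

End continuity.

Section gap_region.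
Context (R : realType) (d : nat).
Local Notation point := 'rV[R]_d.
Variables (H : point -> point -> R) (f : point -> R -> R) (lam : R).
Hypothesis H_per : forall p, zperiodic (fun x => H x p).
Hypothesis H_C1 : Ck 1 (fun z : point * point => H z.1 z.2).
Hypothesis H_conv : forall x, strictly_convex (H x).
Hypothesis H_coercive : uniformly_coercive H.
Hypothesis f_per : forall r : R, 0 <= r -> zperiodic (fun x => f x r).
Hypothesis f_cont : {within [set z : point * R | 0 <= z.2],
  continuous (fun z : point * R => f z.1 z.2)}.
Hypothesis f_incr : forall x (r1 r2 : R), 0 <= r1 -> r1 < r2 -> f x r1 < f x r2.
Hypothesis H_min0 : forall x, H x 0 = Hmin H x.

Let gap := [set x | ell f lam x > Hmin H x].

Lemma open_gap : open gap.
Proof.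
have -> : gap = (fun x => lam + f x 0 - H x 0) @^-1` [set r | 0 < r].
  by apply/seteqP; split => x /=; rewrite /gap /= -H_min0 subr_gt0.
apply: open_comp; last exact: open_gt.
move=> x _.
have cH : {for x, continuous (H^~ 0)} := @C1_continuous_slice R d H H_C1 x.
have cf : {for x, continuous (f^~ 0)} := @within_continuous_slice R d f f_cont x.
exact: continuousB (continuousD (@cst_continuous _ _ lam _) cf) cH.
Qed.

Lemma zperiodic_gap : zperiodic gap.
Proof.
move=> x k; rewrite /gap /= /ell -!H_min0.
by rewrite (f_per (lexx 0) x k) (H_per 0 x k).
Qed.

(** An infimum of reals is a lower bound only of a set that is bounded below:
coercivity provides a bound outside of a ball and compactness inside. *)
Lemma Hmin_le x y : Hmin H x <= H x y.
Proof.
apply: ge_inf; last by exists y.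
have [r Hr] := H_coercive 0; pose A := [set p : point | `|p| <= Num.max r 0].
have cA : compact A.
  apply: bounded_closed_compact.
    exists (Num.max r 0); split; first exact: num_real.
    by move=> M rM p /le_trans; apply; exact: ltW.
  apply: (@preimage_closed _ _ (fun p : point => `|p|) [set t | t <= Num.max r 0]).
    by move=> p _; exact: norm_continuous.
  exact: closed_le.
have [||c _ Hc] := @EVT_min_rV R d (H x) A _ cA.
- by exists 0; rewrite /A /= normr0 le_max lexx orbT.
- apply: continuous_subspaceT => p; apply: differentiable_continuous.
  exact: C1_differentiable_slice.
exists (Num.min 0 (H x c)) => _ [p _ <-]; rewrite ge_min.
have [rp|rp] := leP r `|p|.
  have := Hr p rp; rewrite -[X in X || _]lee_fin => /le_trans -> //.
  by apply: ereal_inf_lbound; exists x.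
by rewrite Hc ?orbT//; apply/mem_set; rewrite /A /= le_max ltW.
Qed.

Variables (s s' q : R).
Hypotheses (s1 : 1 < s) (ss' : s^-1 + s'^-1 = 1).

(** Where [m > 0], orthogonality forces [Du = 0], and strict monotonicity of [f]
pushes [H x 0] strictly above [ell]. *)
Lemma density_vanishes_on_gap (u m : point -> R) :
  weak_solution s s' q H f u m lam ->
  {ae @torus_measure R d, forall x, gap x -> m x = 0}.
Proof.
move=> [_ [Du [sob [m0 _ LV] _ HJ df]]].
have [_ LD _] := sob.
have orth := div_free_orthogonal s1 ss' sob LV df.
have s1' := conjugate_gt1 s1 ss'; have ss : s'^-1 + s^-1 = 1 by rewrite addrC.
pose F x := dotp (flux H m Du x) (Du x).
have FE x : F x = m x * dotp (DpH H x (Du x)) (Du x).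
  by rewrite /F /flux /dotp mulr_sumr; apply: eq_bigr => i _; rewrite mxE mulrA.
have Dpos x : Du x != 0 -> 0 < dotp (DpH H x (Du x)) (Du x).
  move=> Dx; apply: convex_gradient_gt0 => //.
  - by move=> y; rewrite H_min0 Hmin_le.
  - exact: C1_differentiable_slice.
have D0 x : 0 <= dotp (DpH H x (Du x)) (Du x).
  have [->|/Dpos/ltW//] := eqVneq (Du x) 0; by rewrite dotp0.
have iF : (@torus_measure R d).-integrable setT (EFin \o F).
  apply: integrable_bigsum => i.
  exact: (Lp_torus_mul_integrable s1' s1 ss (LV i) (LD i)).
have F0 : {ae @torus_measure R d, forall x, F x = 0}.
  have mF : measurable_fun setT (EFin \o F) by exact: measurable_int iF.
  have := ae_eq_integral_abs (@torus_measure R d) measurableT mF.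
  case=> [+ _]; rewrite (_ : (\int[_]_(x in _) _)%E = 0%E).
    by move=> /(_ erefl); apply: filterS => x /(_ I) /= [].
  have -> : (\int[@torus_measure R d]_x `|(EFin \o F) x| =
      \int[@torus_measure R d]_x (F x)%:E)%E.
    apply: ae_eq_integral => //; first exact: measurableT_comp.
    apply: filterS m0 => x mx _; rewrite /= ger0_norm// FE mulr_ge0//.
  rewrite -[LHS]fineK ?(integrable_fin_num measurableT iF)//.
  by rewrite -[fine _]/(\int[_]_x F x)%R orth.
apply: filterS3 m0 HJ F0 => x mx Hx Fx gx.
apply/eqP; rewrite eq_le mx andbT leNgt; apply/negP => mpos.
have Dx0 : Du x = 0.
  apply/eqP/negPn/negP => /Dpos Dx; have := mulr_gt0 mpos Dx.
  by rewrite -FE Fx ltxx.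
have := Hx mpos; rewrite Dx0 => E.
have := f_incr x (lexx 0) mpos; move: gx; rewrite /gap /= -H_min0 E /ell.
lra.
Qed.

End gap_region.

Theorem proposition4p6 (R : realType) (d : nat) (hd : (0 < d)%N)
  (s s' q q' : R) (hs : 1 < s) (hq : 1 < q)
  (hss' : s^-1 + s'^-1 = 1) (hqq' : q^-1 + q'^-1 = 1)
  (hembed : sobolev_embedding d s q')
  (H : 'rV[R]_d -> 'rV[R]_d -> R)
  (H_per : forall p, zperiodic (fun x => H x p))
  (H_C1 : Ck 1 (fun z : 'rV[R]_d * 'rV[R]_d => H z.1 z.2))
  (H_conv : forall x, strictly_convex (H x))
  (H_coercive : uniformly_coercive H)
  (f : 'rV[R]_d -> R -> R)
  (f_per : forall r : R, 0 <= r -> zperiodic (fun x => f x r))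
  (f_cont : {within [set z : 'rV[R]_d * R | 0 <= z.2],
               continuous (fun z : 'rV[R]_d * R => f z.1 z.2)})
  (f_incr : forall x (r1 r2 : R), 0 <= r1 -> r1 < r2 -> f x r1 < f x r2)
  (f_growth : exists2 C : R, 0 < C &
     forall x (r : R), 0 <= r -> `|f x r| <= C * (1 + r `^ (q - 1)))
  (H_min0 : forall x, H x 0 = Hmin H x)
  (m : 'rV[R]_d -> R) (lam : R)
  (hm : ergodic_pair s s' q H f m lam) :
  torus_measure (R_gap H f m lam) = 0%E.
Proof.
have [_ [u wu]] := hm.
suff -> : R_gap H f m lam = set0 by rewrite measure0.
rewrite -subset0 => x [Rx gx]; apply: Rx; right.
exists [set x | ell f lam x > Hmin H x] => //; split.
- exact: open_gap.
- exact: zperiodic_gap.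
- by apply: density_vanishes_on_gap wu.
Qed.
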